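(* Consider the setting and algorithm described in the context. Let $\gamma>0$ and $K_0\ge0$ be such that for all $k\ge K_0$: $\gamma_k=\gamma$, $\delta_k=\delta:=2\nu+L_{\nabla h}+\frac{2\|A\|^2}{\gamma}$ and $\|z^{k+1}\|\le\min\left(\frac{\varepsilon}{\gamma},\sqrt{\frac{2\varepsilon}{\gamma}}\right)$. Let $0<m\le M$ be constants with $m<f(Kx^k)\le M$ for all $k\ge1$, and let $K_1\ge K_0+1$ be such that $m\le\langle Kx^k,y^k\rangle-f^*(y^k)\le f(Kx^k)\le M$ for all $k\ge K_1$. Let $\Gamma(x,y,z,u):=\frac{\Psi(x,z,u,\delta,\gamma)}{\langle Kx,y\rangle-f^*(y)}$ on $\{(x,y)\in\mathbb{R}^n\times\operatorname{dom}f^*:\langle Kx,y\rangle-f^*(y)>m/2\}\times\operatorname{dom}g^*\times\mathbb{R}^n$. Suppose that $f^*$ is calm at every point of its effective domain and that $g$ is essentially strictly convex. Then there exists $\zeta>0$ such that for all $k\ge K_1$, $\operatorname{dist}\big(0,\partial\Gamma(x^{k+1},y^{k+1},z^{k+1},u^{k+1})\big)\le\zeta\big(\|x^k-x^{k+1}\|+\|u^k-u^{k+1}\|+\|z^k-z^{k+1}\|\big)$, where $\partial$ denotes the limiting subdifferential.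
   Context: Setting: $\mathcal{S}\subseteq\mathbb{R}^n$ nonempty, convex, compact; $A:\mathbb{R}^n\to\mathbb{R}^s$, $K:\mathbb{R}^n\to\mathbb{R}^p$ linear with adjoints $A^*,K^*$ and operator norm $\|A\|$; $g:\mathbb{R}^s\to\mathbb{R}\cup\{+\infty\}$ proper, convex, lsc; $h:\mathbb{R}^n\to\mathbb{R}$ differentiable on an open set containing $\mathcal{S}$ with $L_{\nabla h}$-Lipschitz gradient there; $f:\mathbb{R}^p\to\mathbb{R}\cup\{+\infty\}$ proper, convex, lsc with $K(\mathcal{S})\subseteq\operatorname{int}(\operatorname{dom}f)$ and $f(Kx)>0$ on $\mathcal{S}$; $\mathcal{S}\cap A^{-1}(\operatorname{dom}g)\ne\emptyset$, $\inf_{x\in\mathcal{S}}\{g(Ax)+h(x)\}>0$; $A(\mathcal{S})\subseteq\operatorname{dom}(\partial g)$ and there is $\ell>0$ with $\operatorname{dist}(0,\partial g(Ax))\le\ell$ for all $x\in\mathcal{S}$. Notation: $f^*,g^*$ Fenchel conjugates; $\iota_{\mathcal{S}}$ indicator; $\operatorname{Proj}_{\mathcal{S}}$ projection; $\operatorname{prox}_{\varphi,\kappa}(x)=\arg\min_y\{\varphi(y)+\frac1{2\kappa}\|y-x\|^2\}$; $\Psi(x,z,u,\delta,\gamma):=\langle z,Ax\rangle-g^*(z)+h(x)+\iota_{\mathcal{S}}(x)+\frac{\delta}{2}\|x-u\|^2-\frac{\gamma}{2}\|z\|^2$. A function $\varphi$ is calm at $\hat y\in\operatorname{dom}\varphi$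 if there are $\epsilon,\kappa>0$ with $|\varphi(y)-\varphi(\hat y)|\le\kappa\|y-\hat y\|$ whenever $\|y-\hat y\|<\epsilon$. A proper function is essentially strictly convex if it is strictly convex on every convex subset of $\operatorname{dom}(\partial g)$. Algorithm: given $0<\beta<2$, $\nu>0$, $0<q<1$, $\delta_0,\theta_0>0$, $\gamma_0=1$, $\varepsilon>0$ and $(x^0,z^0,u^0)$, for $k\ge0$: choose $y^{k+1}\in\partial f(Kx^k)$; $x^{k+1}:=\operatorname{Proj}_{\mathcal{S}}(u^k+\frac{\theta_k}{\delta_k}K^*y^{k+1}-\frac1{\delta_k}\nabla h(x^k)-\frac1{\delta_k}A^*z^k)$; $u^{k+1}:=(1-\beta)u^k+\beta x^{k+1}$; take the smallest $j_k\ge0$ such that with $\gamma_{k,j_k}:=\gamma_kq^{j_k}$, $z^{k+1,j_k}:=\operatorname{prox}_{g^*,1/\gamma_{k,j_k}}(Ax^{k+1}/\gamma_{k,j_k})$ one has $\theta_{k+1}:=\Psi(x^{k+1},z^{k+1,j_k},u^{k+1},\delta_k,\gamma_{k,j_k})/f(Kx^{k+1})>0$; set $\gamma_{k+1}:=\gamma_{k,j_k}$, $\delta_{k+1}:=2\nu+L_{\nabla h}+2\|A\|^2/\gamma_{k+1}$, $z^{k+1}:=z^{k+1,j_k}$; if $\|z^{k+1}\|>\min(\varepsilon/\gamma_{k+1},\sqrt{2\varepsilon/\gamma_{k+1}})$, replace $\gamma_{k+1}$ by $\gamma_{k+1}q$ and recompute $\delta_{k+1}$ by the same formula. *)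

(* Defs.v *)
(* MathComp + MathComp-Analysis over an abstract R : realType.
   Vectors of R^d are row vectors 'rV[R]_d, linear maps R^n -> R^s are
   matrices 'M[R]_(n,s) acting by x *m A (adjoint: z *m A^T).
   Extended-real valued functions take values in \bar R. *)
From HB Require Import structures.
From mathcomp Require Import all_boot all_order all_algebra.
From mathcomp Require Import all_classical all_reals all_analysis.
Set Implicit Arguments. Unset Strict Implicit. Unset Printing Implicit Defensive.
Import Order.TTheory GRing.Theory Num.Theory.
Import numFieldNormedType.Exports.
Local Open Scope classical_set_scope.
Local Open Scope ring_scope.

Section Defs.
Variable R : realType.

Definition dotv (d : nat) (x y : 'rV[R]_d) : R := \sum_(i < d) x 0 i * y 0 i.
Definition normv (d : nat) (x : 'rV[R]_d) : R := Num.sqrt (dotv x x).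

Definition opnorm (n s : nat) (A : 'M[R]_(n, s)) : R :=
  sup [set normv (x *m A) | x in [set x : 'rV[R]_n | normv x <= 1]].

Definition convex_setv (d : nat) (C : set 'rV[R]_d) : Prop :=
  forall (x y : 'rV[R]_d) (t : R), C x -> C y -> 0 <= t <= 1 -> C (t *: x + (1 - t) *: y).

Definition edom (d : nat) (phi : 'rV[R]_d -> \bar R) : set 'rV[R]_d :=
  [set x | (phi x < +oo)%E].

Definition proper_fun (d : nat) (phi : 'rV[R]_d -> \bar R) : Prop :=
  (exists x, phi x \is a fin_num) /\ (forall x, phi x != -oo%E).

Definition convex_efun (d : nat) (phi : 'rV[R]_d -> \bar R) : Prop :=
  forall (x y : 'rV[R]_d) (t : R), 0 < t < 1 ->
    (phi (t *: x + (1 - t) *: y)%R <= t%:E * phi x + (1 - t)%R%:E * phi y)%E.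

Definition lsc_fun (d : nat) (phi : 'rV[R]_d -> \bar R) : Prop :=
  forall x (a : R), (a%:E < phi x)%E ->
    exists2 r, 0 < r & forall y, normv (y - x) < r -> (a%:E < phi y)%E.

Definition int_edom (d : nat) (phi : 'rV[R]_d -> \bar R) : set 'rV[R]_d :=
  [set x | exists2 r, 0 < r & forall y, normv (y - x) < r -> edom phi y].

Definition fconj (d : nat) (phi : 'rV[R]_d -> \bar R) (y : 'rV[R]_d) : \bar R :=
  ereal_sup [set ((dotv x y)%:E - phi x)%E | x in [set: 'rV[R]_d]].

Definition csubdiff (d : nat) (phi : 'rV[R]_d -> \bar R) (x : 'rV[R]_d)
  : set 'rV[R]_d :=
  [set v | phi x \is a fin_num /\
           forall y, (phi x + (dotv v (y - x))%:E <= phi y)%E].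

Definition dom_csubdiff (d : nat) (phi : 'rV[R]_d -> \bar R) : set 'rV[R]_d :=
  [set x | csubdiff phi x !=set0].

(* distance from 0 to a set (= +oo for the empty set) *)
Definition dist0 (d : nat) (V : set 'rV[R]_d) : \bar R :=
  ereal_inf [set (normv v)%:E | v in V].

Definition iota (d : nat) (S : set 'rV[R]_d) (x : 'rV[R]_d) : \bar R :=
  if `[< S x >] then 0%E else +oo%E.

(* Euclidean projection / proximal point (as relations; both are unique) *)
Definition is_proj (d : nat) (S : set 'rV[R]_d) (w p : 'rV[R]_d) : Prop :=
  S p /\ forall q, S q -> normv (w - p) <= normv (w - q).

Definition is_prox (d : nat) (phi : 'rV[R]_d -> \bar R) (kappa : R)
  (x p : 'rV[R]_d) : Prop :=
  forall w, (phi p + ((2 * kappa)^-1 * normv (p - x) ^+ 2)%:E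
             <= phi w + ((2 * kappa)^-1 * normv (w - x) ^+ 2)%:E)%E.

Definition calm_at (d : nat) (phi : 'rV[R]_d -> \bar R) (yh : 'rV[R]_d) : Prop :=
  exists eps kappa, 0 < eps /\ 0 < kappa /\
    forall y, normv (y - yh) < eps ->
      (`| phi y - phi yh | <= (kappa * normv (y - yh))%:E)%E.

Definition ess_strictly_convex (d : nat) (phi : 'rV[R]_d -> \bar R) : Prop :=
  forall C : set 'rV[R]_d, convex_setv C -> C `<=` dom_csubdiff phi ->
    forall (x y : 'rV[R]_d) (t : R), C x -> C y -> x != y -> 0 < t < 1 ->
      (phi (t *: x + (1 - t) *: y)%R < t%:E * phi x + (1 - t)%R%:E * phi y)%E.

Definition frechet_subdiff (d : nat) (phi : 'rV[R]_d -> \bar R) (x : 'rV[R]_d)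
  : set 'rV[R]_d :=
  [set v | phi x \is a fin_num /\
     forall e, 0 < e -> exists2 r, 0 < r & forall y, normv (y - x) < r ->
       (phi x + (dotv v (y - x) - e * normv (y - x))%:E <= phi y)%E].

Definition seq_cvg_to (d : nat) (a : nat -> 'rV[R]_d) (l : 'rV[R]_d) : Prop :=
  forall e, 0 < e -> exists N, forall k, (N <= k)%N -> normv (a k - l) < e.

Definition limiting_subdiff (d : nat) (phi : 'rV[R]_d -> \bar R) (x : 'rV[R]_d)
  : set 'rV[R]_d :=
  [set v | exists (xk vk : nat -> 'rV[R]_d),
     [/\ seq_cvg_to xk x, seq_cvg_to vk v, phi x \is a fin_num,
         (forall e, 0 < e -> exists N, forall k, (N <= k)%N ->
             `| fine (phi (xk k)) - fine (phi x) | < e)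
       & forall k, frechet_subdiff phi (xk k) (vk k)]].

Definition Psi (n s : nat) (g : 'rV[R]_s -> \bar R) (h : 'rV[R]_n -> R)
  (A : 'M[R]_(n, s)) (S : set 'rV[R]_n)
  (x : 'rV[R]_n) (z : 'rV[R]_s) (u : 'rV[R]_n) (delta gamma : R) : \bar R :=
  ((dotv z (x *m A))%:E - fconj g z + (h x)%:E + iota S x
   + (delta / 2 * normv (x - u) ^+ 2)%:E - (gamma / 2 * normv z ^+ 2)%:E)%E.

Definition Gamma (n p s : nat) (f : 'rV[R]_p -> \bar R) (g : 'rV[R]_s -> \bar R)
  (h : 'rV[R]_n -> R) (A : 'M[R]_(n, s)) (K : 'M[R]_(n, p)) (S : set 'rV[R]_n)
  (m delta gamma : R)
  (x : 'rV[R]_n) (y : 'rV[R]_p) (z : 'rV[R]_s) (u : 'rV[R]_n) : \bar R :=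
  let den := ((dotv (x *m K) y)%:E - fconj f y)%E in
  if `[< [/\ edom (fconj f) y, ((m / 2)%:E < den)%E & edom (fconj g) z] >]
  then (Psi g h A S x z u delta gamma * ((fine den)^-1)%:E)%E
  else +oo%E.

Definition Gamma_vec (n p s : nat) (f : 'rV[R]_p -> \bar R) (g : 'rV[R]_s -> \bar R)
  (h : 'rV[R]_n -> R) (A : 'M[R]_(n, s)) (K : 'M[R]_(n, p)) (S : set 'rV[R]_n)
  (m delta gamma : R) (w : 'rV[R]_(n + p + s + n)) : \bar R :=
  Gamma f g h A K S m delta gamma
    (lsubmx (lsubmx (lsubmx w))) (rsubmx (lsubmx (lsubmx w)))
    (rsubmx (lsubmx w)) (rsubmx w).

Definition pt4 (n p s : nat) (x : 'rV[R]_n) (y : 'rV[R]_p) (z : 'rV[R]_s)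
  (u : 'rV[R]_n) : 'rV[R]_(n + p + s + n) :=
  row_mx (row_mx (row_mx x y) z) u.

Definition is_gradient_on (n : nat) (h : 'rV[R]_n -> R) (gradh : 'rV[R]_n -> 'rV[R]_n)
  (U : set 'rV[R]_n) : Prop :=
  forall x, U x -> forall e, 0 < e -> exists2 r, 0 < r & forall y,
    normv (y - x) < r -> `| h y - h x - dotv (gradh x) (y - x) | <= e * normv (y - x).

Definition alg_iterates (n p s : nat) (S : set 'rV[R]_n) (A : 'M[R]_(n, s))
  (K : 'M[R]_(n, p)) (f : 'rV[R]_p -> \bar R) (g : 'rV[R]_s -> \bar R)
  (h : 'rV[R]_n -> R) (gradh : 'rV[R]_n -> 'rV[R]_n) (L : R)
  (beta nu q delta0 theta0 eps : R)
  (x u : nat -> 'rV[R]_n) (z : nat -> 'rV[R]_s) (y : nat -> 'rV[R]_p)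
  (theta delta gamma : nat -> R) (j : nat -> nat) : Prop :=
  [/\ gamma 0%N = 1, delta 0%N = delta0, theta 0%N = theta0 &
  forall k : nat,
    let ratio (zz : 'rV[R]_s) (gm : R) :=
      (Psi g h A S (x k.+1) zz (u k.+1) (delta k) gm
       * ((fine (f (x k.+1 *m K)))^-1)%:E)%E in
    let gam' := gamma k * q ^+ j k in
    [/\ csubdiff f (x k *m K) (y k.+1),
        is_proj S (u k + (theta k / delta k) *: (y k.+1 *m K^T)
                   - (delta k)^-1 *: gradh (x k)
                   - (delta k)^-1 *: (z k *m A^T)) (x k.+1),
        u k.+1 = (1 - beta) *: u k + beta *: x k.+1,
     [/\
        (forall i : nat, (i < j k)%N -> forall zz,
            is_prox (fconj g) (gamma k * q ^+ i)^-1
                    ((gamma k * q ^+ i)^-1 *: (x k.+1 *m A)) zz ->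
            (ratio zz (gamma k * q ^+ i)%R <= 0)%E),
        is_prox (fconj g) gam'^-1 (gam'^-1 *: (x k.+1 *m A)) (z k.+1),
        (theta k.+1)%:E = ratio (z k.+1) gam'
      & 0 < theta k.+1] &
     [/\
        gamma k.+1 = (if Num.min (eps / gam') (Num.sqrt (2 * eps / gam'))
                         < normv (z k.+1)
                      then gam' * q else gam')
      & delta k.+1 = 2 * nu + L + 2 * opnorm A ^+ 2 / gamma k.+1]]].

End Defs.

(* Main.v *)
(* The proof exhibits one Frechet subgradient of [Gamma] at the new iterate.
   Write [Gamma = N / D] and [Q = N / D > 0] at that point. If [p] is a Frechet
   subgradient of [N - Q * D], then [p / D] is one of the quotient, because [D]
   is calm there: this is where calmness of [f^*] enters. In [N - Q * D] the
   function [f^*] appears with the sign [+ Q], so [K x^k], which lies in the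
   subdifferential of [f^*] at [y^(k+1)], may be used. The function [g^*] appears
   with the sign [-], so it has to be differentiable at [z^(k+1)]. The proximal
   step gives [z^(k+1)] in the subdifferential of [g] at
   [a = A x^(k+1) - gamma z^(k+1)]; since [g] is essentially strictly convex, [a]
   is the only minimiser of [g - <z^(k+1), .>], and in finite dimension this
   minimum is well posed, which says that [g^*] has gradient [a] at [z^(k+1)].
   The [z]-block of [p] is then zero, and the normal vector provided by the
   projection step turns the other blocks into differences of consecutive
   iterates, up to the term [(theta_k - Q) K^* y^(k+1)]. The latter is controlled
   since [D = f (K x^k) + <K (x^(k+1) - x^k), y^(k+1)>] and since the numerators
   at consecutive iterates differ by a multiple of the steps, the iterates and
   the subgradients [y^k] being bounded. *)

Require Import Defs.
From HB Require Import structures.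
From mathcomp Require Import all_boot all_order all_algebra.
From mathcomp Require Import all_classical all_reals all_analysis.
From mathcomp Require Import ring lra.
Import Order.TTheory GRing.Theory Num.Theory.
Import numFieldNormedType.Exports.
Local Open Scope classical_set_scope.
Local Open Scope ring_scope.

(** * Euclidean vectors *)

Section EuclideanVectors.
Context {R : realType}.

Lemma dotvC {d} (x y : 'rV[R]_d) : dotv x y = dotv y x.
Proof. by apply: eq_bigr => i _; rewrite mulrC. Qed.

Lemma dotvDl {d} (x y w : 'rV[R]_d) : dotv (x + y) w = dotv x w + dotv y w.
Proof. by rewrite -big_split; apply: eq_bigr => i _; rewrite mxE mulrDl. Qed.

Lemma dotvDr {d} (w x y : 'rV[R]_d) : dotv w (x + y) = dotv w x + dotv w y.
Proof. by rewrite dotvC dotvDl !(dotvC w). Qed.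

Lemma dotvZl {d} c (x w : 'rV[R]_d) : dotv (c *: x) w = c * dotv x w.
Proof. by rewrite /dotv mulr_sumr; apply: eq_bigr => i _; rewrite mxE mulrA. Qed.

Lemma dotvZr {d} c (w x : 'rV[R]_d) : dotv w (c *: x) = c * dotv w x.
Proof. by rewrite dotvC dotvZl dotvC. Qed.

Lemma dotvNl {d} (x w : 'rV[R]_d) : dotv (- x) w = - dotv x w.
Proof. by rewrite -scaleN1r dotvZl mulN1r. Qed.

Lemma dotvNr {d} (w x : 'rV[R]_d) : dotv w (- x) = - dotv w x.
Proof. by rewrite dotvC dotvNl dotvC. Qed.

Lemma dotv0l {d} (w : 'rV[R]_d) : dotv 0 w = 0.
Proof. by rewrite -(scale0r 0) dotvZl mul0r. Qed.

Lemma dotv0r {d} (w : 'rV[R]_d) : dotv w 0 = 0.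
Proof. by rewrite dotvC dotv0l. Qed.

Definition dotvE := (@dotvDl, @dotvDr, @dotvNl, @dotvNr, @dotvZl, @dotvZr).

Lemma dotv_mulmx {a b} (x : 'rV[R]_a) (B : 'M[R]_(a, b)) (w : 'rV[R]_b) :
  dotv (x *m B) w = dotv x (w *m B^T).
Proof.
transitivity (\sum_i \sum_j x 0 j * B j i * w 0 i).
  by apply: eq_bigr => i _; rewrite mxE mulr_suml.
rewrite exchange_big /=; apply: eq_bigr => j _; rewrite mxE mulr_sumr.
by apply: eq_bigr => i _; rewrite mxE -mulrA (mulrC (B j i)).
Qed.

Lemma dotv_row_mx {a b} (x x' : 'rV[R]_a) (y y' : 'rV[R]_b) :
  dotv (row_mx x y) (row_mx x' y') = dotv x x' + dotv y y'.
Proof.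
rewrite /dotv big_split_ord /=; congr (_ + _); apply: eq_bigr => i _.
  by rewrite !row_mxEl.
by rewrite !row_mxEr.
Qed.

Lemma dotv_ge0 {d} (x : 'rV[R]_d) : 0 <= dotv x x.
Proof. by apply: sumr_ge0 => i _; rewrite -expr2 sqr_ge0. Qed.

Lemma normv_ge0 {d} (x : 'rV[R]_d) : 0 <= normv x.
Proof. exact: sqrtr_ge0. Qed.

Lemma sqr_normv {d} (x : 'rV[R]_d) : normv x ^+ 2 = dotv x x.
Proof. by rewrite sqr_sqrtr// dotv_ge0. Qed.

Lemma normv0 {d} : normv (0 : 'rV[R]_d) = 0.
Proof. by rewrite /normv dotv0l sqrtr0. Qed.

Lemma normvZ {d} c (x : 'rV[R]_d) : normv (c *: x) = `|c| * normv x.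
Proof.
by rewrite /normv dotvZl dotvZr mulrA -expr2 sqrtrM ?sqr_ge0// sqrtr_sqr.
Qed.

Lemma normvN {d} (x : 'rV[R]_d) : normv (- x) = normv x.
Proof. by rewrite -scaleN1r normvZ normrN1 mul1r. Qed.

Lemma normvBC {d} (x y : 'rV[R]_d) : normv (x - y) = normv (y - x).
Proof. by rewrite -normvN opprB. Qed.

Lemma normv_eq0 {d} (x : 'rV[R]_d) : normv x = 0 -> x = 0.
Proof.
move=> x0; have /eqP : dotv x x = 0 by rewrite -sqr_normv x0 expr0n.
rewrite psumr_eq0 => [/allP xx0|i _]; last by rewrite -expr2 sqr_ge0.
apply/rowP => i; have := xx0 i (mem_index_enum _).
by rewrite -expr2 sqrf_eq0 mxE => /eqP.
Qed.

(** Cauchy-Schwarz: the squared norm of [|y|^2 x - <x,y> y] is nonnegative and equals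
    [|y|^2 (|x|^2 |y|^2 - <x,y>^2)]. *)
Lemma dotv_le_normv {d} (x y : 'rV[R]_d) : `|dotv x y| <= normv x * normv y.
Proof.
have [/normv_eq0 ->|y0] := eqVneq (normv y) 0.
  by rewrite dotv0r normr0 normv0 mulr0.
have yy0 : 0 < normv y by rewrite lt_neqAle eq_sym y0 normv_ge0.
rewrite -ler_sqr ?nnegrE// ?mulr_ge0 ?normv_ge0//.
rewrite real_normK ?num_real// exprMn -(@ler_pM2r _ (normv y ^+ 2)) ?exprn_gt0//.
have := dotv_ge0 (normv y ^+ 2 *: x - dotv x y *: y).
rewrite !dotvE -!sqr_normv (dotvC y x).
set a := normv x; set b := normv y; set c := dotv x y => H.
suff : 0 <= b ^+ 2 * (a ^+ 2 * b ^+ 2 - c ^+ 2).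
  by rewrite pmulr_rge0 ?exprn_gt0// subr_ge0 ler_pM2r ?exprn_gt0.
by apply: le_trans H _; rewrite le_eqVlt; apply/orP; left; apply/eqP; ring.
Qed.

Lemma dotv_le {d} (x y : 'rV[R]_d) : dotv x y <= normv x * normv y.
Proof. exact: le_trans (ler_norm _) (dotv_le_normv _ _). Qed.

Lemma ler_normvD {d} (x y : 'rV[R]_d) : normv (x + y) <= normv x + normv y.
Proof.
rewrite -ler_sqr ?nnegrE ?addr_ge0 ?normv_ge0//.
rewrite sqr_normv !dotvE (dotvC y x) -!sqr_normv sqrrD.
have := dotv_le x y; lra.
Qed.

Lemma ler_normvB {d} (x y : 'rV[R]_d) : normv (x - y) <= normv x + normv y.
Proof. by rewrite -(normvN y) ler_normvD. Qed.

Lemma ler_dist_normv {d} (x y : 'rV[R]_d) :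
  `|normv x - normv y| <= normv (x - y).
Proof.
have := ler_normvD (x - y) y; have := ler_normvD (y - x) x.
by rewrite !subrK (normvBC y x) ler_norml => ? ?; apply/andP; split; lra.
Qed.

Lemma normr_coord_le {d} (x : 'rV[R]_d) i : `|x 0 i| <= normv x.
Proof.
rewrite -ler_sqr ?nnegrE ?normv_ge0// sqr_normv real_normK ?num_real//.
rewrite /dotv (bigD1 i)//= -expr2 lerDl sumr_ge0// => k _.
by rewrite -expr2 sqr_ge0.
Qed.

Lemma normv_le_sum {d} (x : 'rV[R]_d) : normv x <= \sum_i `|x 0 i|.
Proof.
have s0 : 0 <= \sum_i `|x 0 i| by apply: sumr_ge0.
rewrite -ler_sqr ?nnegrE ?normv_ge0// sqr_normv expr2 mulr_suml ler_sum// => i _.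
apply: le_trans (ler_norm _) _; rewrite normrM ler_wpM2l//.
by rewrite (bigD1 i)//= lerDl sumr_ge0.
Qed.

Lemma mulmx_bounded {a b} (B : 'M[R]_(a, b)) :
  exists2 C, 0 <= C & forall x, normv (x *m B) <= C * normv x.
Proof.
exists (\sum_i normv (row i B)).
  by apply: sumr_ge0 => i _; exact: normv_ge0.
move=> x; rewrite mulmx_sum_row mulr_suml.
elim/big_rec2: _ => [|i w c _ IH]; first by rewrite normv0.
apply: le_trans (ler_normvD _ _) _; apply: lerD => //.
by rewrite normvZ mulrC ler_wpM2l ?normv_ge0 ?normr_coord_le.
Qed.

Lemma normv_row_mx {a b} (x : 'rV[R]_a) (y : 'rV[R]_b) :
  normv (row_mx x y) <= normv x + normv y.
Proof.
rewrite -ler_sqr ?nnegrE ?addr_ge0 ?normv_ge0//.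
rewrite sqr_normv dotv_row_mx -!sqr_normv sqrrD.
have := mulr_ge0 (normv_ge0 x) (normv_ge0 y); lra.
Qed.

Lemma normv_row_mx_ge {a b} (x : 'rV[R]_a) (y : 'rV[R]_b) :
  normv x <= normv (row_mx x y) /\ normv y <= normv (row_mx x y).
Proof.
split; rewrite -ler_sqr ?nnegrE ?normv_ge0// sqr_normv [leRHS]sqr_normv.
  by rewrite dotv_row_mx lerDl dotv_ge0.
by rewrite dotv_row_mx lerDr dotv_ge0.
Qed.

Lemma mx_norm_le_normv {d} (x : 'rV[R]_d) : `|x| <= normv x.
Proof.
rewrite [leLHS]/Num.norm /= mx_normrE; apply: bigmax_le => [|[i k] _].
  exact: normv_ge0.
by rewrite /= (ord1 i) normr_coord_le.
Qed.

Lemma normv_le_mx_norm {d} (x : 'rV[R]_d) : normv x <= d%:R * `|x|.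
Proof.
apply: le_trans (normv_le_sum x) _.
rewrite mulr_natl -[X in _ *+ X]card_ord -sumr_const ler_sum// => i _.
rewrite [leRHS]/Num.norm /= mx_normrE.
by apply/bigmax_geP; right => /=; exists (0, i).
Qed.

(** The ambient topology comes from the maximum norm; the bounds [|x| <= normv x <= d |x|] let
    Euclidean balls generate the same neighbourhoods. *)
Lemma nbhs_normvP {d} (x : 'rV[R]_d) (P : set 'rV[R]_d) :
  nbhs x P <-> exists2 r, 0 < r & forall y, normv (y - x) < r -> P y.
Proof.
split=> [/nbhs_ballP[r /= r0 rP]|[r r0 rP]].
  exists r => // y yxr; apply: rP; rewrite -ball_normE /= distrC.
  exact: le_lt_trans (mx_norm_le_normv _) _.
(* The [+ 1] keeps the denominator positive when [d = 0]. *)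
apply/nbhs_ballP; exists (r / (d%:R + 1)) => /=.
  by rewrite divr_gt0// ltr_wpDl.
move=> y; rewrite -ball_normE /= distrC ltr_pdivlMr ?ltr_wpDl// => yxr.
apply: rP; apply: le_lt_trans (normv_le_mx_norm _) _.
apply: le_lt_trans yxr; rewrite mulrC ler_wpM2l//; lra.
Qed.

Lemma compact_normv_bounded {d} (S : set 'rV[R]_d) :
  compact S -> exists2 B, 0 <= B & forall x, S x -> normv x <= B.
Proof.
move=> /compact_bounded[M [_ SM]].
have B0 : 0 <= `|M| + 1 by rewrite addr_ge0.
exists (d%:R * (`|M| + 1)); first by rewrite mulr_ge0.
move=> x Sx; apply: le_trans (normv_le_mx_norm x) _; apply: ler_wpM2l => //.
by apply: (SM (`|M| + 1)) => //; have := ler_norm M; lra.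
Qed.

Lemma continuous_normv {d} (c : 'rV[R]_d) :
  continuous (fun x : 'rV[R]_d => normv (x - c)).
Proof.
move=> x P /nbhs_ballP[e /= e0 eP]; apply/nbhs_normvP; exists e => // y yx.
apply: eP; rewrite -ball_normE /= distrC.
by apply: le_lt_trans (ler_dist_normv _ _) _; rewrite opprB addrA subrK.
Qed.

(** Covers closed balls ([C] a half-line) and spheres ([C] a single value) at once. *)
Lemma compact_normv_preimage {d} (c : 'rV[R]_d) (C : set R) r :
  closed C -> (forall t, C t -> t <= r) -> compact [set x | C (normv (x - c))].
Proof.
move=> Ccl Cr; apply: bounded_closed_compact.
  exists (`|r| + normv c); split; first exact: num_real.
  move=> M rM x /= /Cr xr; apply: ltW; apply: le_lt_trans rM.
  apply: le_trans (mx_norm_le_normv _) _.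
  have := ler_normvD (x - c) c; rewrite subrK; have := ler_norm r; lra.
apply: (@preimage_closed _ _ (fun x : 'rV[R]_d => normv (x - c))) Ccl.
by move=> x _; exact: continuous_normv.
Qed.

End EuclideanVectors.

(** * Lower semicontinuous functions on compact sets *)

Section LowerSemicontinuity.
Context {R : realType}.

(* Along a total preorder, finitely many local indices have a common upper
   bound, so a monotone local property becomes uniform on a compact set. *)
Lemma compact_uniform {d} {I : Type} (ord : I -> I -> Prop)
    (P : I -> 'rV[R]_d -> Prop) (C : set 'rV[R]_d) :
  I -> (forall i, ord i i) ->
  (forall i k l, ord i k -> ord k l -> ord i l) ->
  (forall i k, ord i k \/ ord k i) ->
  (forall i k x, ord i k -> P i x -> P k x) ->
  compact C ->
  (forall x, C x -> exists i, exists2 r, 0 < r &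
     forall x', normv (x' - x) < r -> P i x') ->
  exists i, forall x, C x -> P i x.
Proof.
move=> i0 refl trans total mono /compact_near_coveringP Ccov loc.
(* The tails of [ord] form a filter, to which the near-covering form of compactness applies. *)
pose F : set_system I := [set E | exists i, forall k, ord i k -> E k].
have FF : Filter F.
  split; first by exists i0.
  - move=> E E' [i iE] [k kE'].
    have [ik|ki] := total i k.
      by exists k => l kl; split; [apply: iE; exact: trans kl|exact: kE'].
    by exists i => l il; split; [exact: iE|apply: kE'; exact: trans il].
  - by move=> E E' EE' [i iE]; exists i => k /iE /EE'.
have [] := Ccov I F P FF; last by move=> i iC; exists i => x; exact: (iC i).
move=> x /loc[i [r r0 rP]].
exists ([set x' | normv (x' - x) < r], [set k | ord i k]); last first.
  by move=> [x' k] /= [x'r ik]; exact: mono ik (rP _ x'r).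
by split; [apply/nbhs_normvP; exists r|exists i].
Qed.

(** Without a minimiser, each [x] in [C] has some [w] in [C] of smaller value, and by semicontinuity
    [w] stays below [phi] near [x]. Ordering the points of [C] by decreasing value, compactness
    yields one [w] strictly below all of [C], hence below itself. *)
Lemma lsc_compact_min {d} (phi : 'rV[R]_d -> \bar R) (C : set 'rV[R]_d) :
  (forall x, phi x != -oo%E) -> lsc_fun phi -> compact C -> C !=set0 ->
  exists2 a, C a & forall x, C x -> (phi a <= phi x)%E.
Proof.
move=> noNy lsc Ccpt [x0 Cx0]; apply: contrapT => nomin.
have lt_ex x : C x -> exists2 w, C w & (phi w < phi x)%E.
  move=> Cx; apply: contrapT => nw; apply: nomin; exists x => // w Cw.
  by rewrite leNgt; apply/negP => wx; apply: nw; exists w.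
have [] := @compact_uniform d {x | C x}
  (fun i k => (phi (sval k) <= phi (sval i))%E)
  (fun i x => (phi (sval i) < phi x)%E) C (exist _ _ Cx0) _ _ _ _ Ccpt.
- by move=> i.
- by move=> i k l /[swap]; exact: le_trans.
- by move=> i k; apply/orP; exact: le_total.
- by move=> i k x /le_lt_trans; exact.
- move=> x /lt_ex[w Cw wx]; exists (exist _ _ Cw) => /=.
  have wfin : phi w \is a fin_num.
    rewrite fin_numE noNy/=; apply/eqP => wy.
    by move: wx; rewrite wy ltNge leey.
  move: wx; rewrite -(fineK wfin) => /lsc[r r0 rP].
  by exists r.
- by move=> i /(_ _ (svalP i)); rewrite ltxx.
Qed.

End LowerSemicontinuity.

(** * Conjugates and proximal points *)

Section ConvexAnalysis.
Context {R : realType}.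

Lemma fin_num_noNy (c : \bar R) (r : R) :
  c != -oo%E -> (c <= r%:E)%E -> exists2 t, c = t%:E & t <= r.
Proof. by case: c => [t| |]// _; rewrite lee_fin => tr; exists t. Qed.

Lemma csubdiffP {d} (phi : 'rV[R]_d -> \bar R) x v :
  csubdiff phi x v <-> exists2 r, phi x = r%:E &
    forall y, ((r + dotv v (y - x))%:E <= phi y)%E.
Proof.
split=> [[xfin xv]|[r xr xv]].
  by exists (fine (phi x)) => [|y]; rewrite ?EFinD fineK// xv.
by split=> [|y]; rewrite xr// -EFinD.
Qed.

Lemma convex_efun_fin {d} (phi : 'rV[R]_d -> \bar R) x y t r r' :
  convex_efun phi -> (forall x, phi x != -oo%E) -> 0 < t < 1 ->
  phi x = r%:E -> phi y = r'%:E ->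
  exists2 c, phi (t *: x + (1 - t) *: y) = c%:E & c <= t * r + (1 - t) * r'.
Proof.
move=> cvx noNy t01 xr yr'; apply: fin_num_noNy => //.
by have := cvx x y t t01; rewrite xr yr' -!EFinM -EFinD.
Qed.

Lemma fconj_ge {d} (phi : 'rV[R]_d -> \bar R) x y r :
  phi x = r%:E -> ((dotv x y - r)%:E <= fconj phi y)%E.
Proof. by move=> xr; apply: ereal_sup_ubound; exists x => //; rewrite xr EFinB. Qed.

Lemma fconj_le {d} (phi : 'rV[R]_d -> \bar R) y c :
  (forall x, phi x != -oo%E) ->
  (forall x r, phi x = r%:E -> dotv x y - r <= c) -> (fconj phi y <= c%:E)%E.
Proof.
move=> noNy yc; apply: ge_ereal_sup => _ [w _ <-].
case E : (phi w) (noNy w) => [r| |]// _; last by rewrite addeNy leNye.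
by rewrite -EFinB lee_fin yc.
Qed.

Lemma fconj_noNy {d} (phi : 'rV[R]_d -> \bar R) y :
  proper_fun phi -> fconj phi y != -oo%E.
Proof.
move=> [[x xfin] _]; apply/eqP => yN.
have := fconj_ge phi x y _ (esym (fineK xfin)).
by rewrite yN leeNy_eq.
Qed.

(** Equality case of Fenchel-Young: the subgradient inequality says that [x] attains the supremum
    defining the conjugate at [v]. *)
Lemma fconj_csubdiff {d} (phi : 'rV[R]_d -> \bar R) x v r :
  (forall x, phi x != -oo%E) ->
  csubdiff phi x v -> phi x = r%:E -> fconj phi v = (dotv x v - r)%:E.
Proof.
move=> noNy /csubdiffP[r' xr' xv] xr; apply/eqP.
rewrite eq_le (fconj_ge _ _ _ _ xr) andbT; apply: fconj_le => // w c wc.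
move: xr; rewrite xr' => -[<-]; have := xv w; rewrite wc lee_fin !dotvE.
rewrite (dotvC w) (dotvC x); lra.
Qed.

(** The point [x] gives an affine minorant of the conjugate, which is tight at [v]. *)
Lemma csubdiff_fconj {d} (phi : 'rV[R]_d -> \bar R) x v :
  (forall x, phi x != -oo%E) -> csubdiff phi x v -> csubdiff (fconj phi) v x.
Proof.
move=> noNy xv; have /csubdiffP[r xr _] := xv.
apply/csubdiffP; exists (dotv x v - r); first exact: (fconj_csubdiff phi x).
move=> w; apply: le_trans (fconj_ge _ _ _ _ xr).
by rewrite lee_fin !dotvE; lra.
Qed.

Lemma lsc_funD {d} (phi : 'rV[R]_d -> \bar R) (psi : 'rV[R]_d -> R) :
  lsc_fun phi ->
  (forall x, exists2 c, 0 <= c & forall y, psi x - c * normv (y - x) <= psi y) ->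
  lsc_fun (fun x => (phi x + (psi x)%:E)%E).
Proof.
move=> lsc lip x a; have [c c0 xc] := lip x.
rewrite -lteBlDr// -EFinB => ax.
have [e e0 aex] : exists2 e, 0 < e & ((a - psi x + e)%:E < phi x)%E.
  case: (phi x) ax => [r| |]//.
    by rewrite lte_fin => ar; exists ((r - (a - psi x)) / 2); rewrite ?lte_fin; lra.
  by exists 1 => //; rewrite ltry.
have [r r0 rP] := lsc _ _ aex.
have c1 : 0 < c + 1 by lra.
exists (Num.min r (e / (c + 1))); first by rewrite lt_min r0 divr_gt0.
move=> y; rewrite lt_min => /andP[/rP yr]; rewrite ltr_pdivlMr// => ye.
rewrite -lteBlDr// -EFinB; apply: le_lt_trans yr.
rewrite lee_fin; have := xc y; have := normv_ge0 (y - x); lra.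
Qed.

Lemma sqr_normvD {d} (x y : 'rV[R]_d) :
  normv (x + y) ^+ 2 = normv x ^+ 2 + 2 * dotv x y + normv y ^+ 2.
Proof. by rewrite !sqr_normv !dotvE (dotvC y x); ring. Qed.

Lemma sqr_normv_ge {d} (x y : 'rV[R]_d) :
  normv x ^+ 2 + 2 * dotv x (y - x) <= normv y ^+ 2.
Proof.
by have := dotv_ge0 (y - x); rewrite !sqr_normv !dotvE (dotvC y x); lra.
Qed.

(** The affine minorant with slope [v] at [b] makes every [w] with [|w - b| > |v| / c] worse than
    [b], so it suffices to minimise over a compact ball. *)
Lemma prox_exists {d} (phi : 'rV[R]_d -> \bar R) b c :
  (forall x, phi x != -oo%E) -> lsc_fun phi -> dom_csubdiff phi b -> 0 < c ->
  exists a, forall w, (phi a + (c * normv (a - b) ^+ 2)%:E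
                       <= phi w + (c * normv (w - b) ^+ 2)%:E)%E.
Proof.
move=> noNy lsc [v /csubdiffP[r br bv]] c0.
pose C := [set w | normv (w - b) <= normv v / c].
have Ccpt : compact C.
  exact: (compact_normv_preimage b [set t | t <= normv v / c] (normv v / c)).
have Cb : C b by rewrite /C /= subrr normv0 divr_ge0 ?normv_ge0// ltW.
have [] := @lsc_compact_min _ _
  (fun w => (phi w + (c * normv (w - b) ^+ 2)%:E)%E) C _ _ Ccpt.
- by move=> x; case: (phi x) (noNy x).
- apply: lsc_funD => // x; exists (2 * c * normv (x - b)).
    by rewrite mulr_ge0 ?normv_ge0//; lra.
  move=> y; have := sqr_normv_ge (x - b) (y - b).
  rewrite opprB addrA subrK => /(ler_wpM2l (ltW c0)).
  have := dotv_le_normv (x - b) (y - x); rewrite ler_norml => /andP[+ _].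
  by move=> /(ler_wpM2l (ltW c0)); lra.
- by exists b.
move=> a Ca amin; exists a => w.
have [Cw|] := leP (normv (w - b)) (normv v / c); first exact: amin.
rewrite ltr_pdivrMr// => wb.
apply: le_trans (amin _ Cb) _; rewrite br subrr normv0 expr0n mulr0 -EFinD addr0.
case: (phi w) (bv w) (noNy w) => [r'|_ _|]//; last by rewrite addye// leey.
rewrite -EFinD !lee_fin => H _.
have := dotv_le_normv v (w - b); rewrite ler_norml => /andP[+ _].
by have := ler_wpM2l (normv_ge0 (w - b)) (ltW wb); lra.
Qed.

(** Comparing [a] with [t w + (1 - t) a] and dividing by [t] leaves an error [t B]. Instead of a
    limit, [t] is chosen with [t B <= e] for an arbitrary [e > 0]. *)
Lemma prox_csubdiff {d} (phi : 'rV[R]_d -> \bar R) a b c :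
  proper_fun phi -> convex_efun phi -> 0 < c ->
  (forall w, (phi a + (c * normv (a - b) ^+ 2)%:E
              <= phi w + (c * normv (w - b) ^+ 2)%:E)%E) ->
  csubdiff phi a (2 * c *: (b - a)).
Proof.
move=> [[x0 x0fin] noNy] cvx c0 amin.
have [r ar] : exists r, phi a = r%:E.
  have := amin x0; rewrite -(fineK x0fin).
  by case: (phi a) (noNy a) => [r| |]// _ _; exists r.
apply/csubdiffP; exists r => // w.
case wr : (phi w) (noNy w) => [r'| |]// _; last by rewrite leey.
rewrite lee_fin; apply/ler_addgt0Pr => e e0.
set B := c * normv (w - a) ^+ 2.
have B0 : 0 <= B by rewrite mulr_ge0 ?sqr_ge0// ltW.
have B1 : 0 < B + e + 1 by lra.
pose t := e / (B + e + 1).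
have t0 : 0 < t by rewrite divr_gt0.
have tB : t * (B + e + 1) = e by rewrite divfK// gt_eqF.
have t1 : t < 1 by rewrite ltr_pdivrMr//; lra.
have t01 : 0 < t < 1 by rewrite t0.
have [s ts st] := convex_efun_fin _ _ _ _ _ _ cvx noNy t01 wr ar.
have := amin (t *: w + (1 - t) *: a); rewrite ts ar -!EFinD lee_fin.
have -> : t *: w + (1 - t) *: a - b = (a - b) + t *: (w - a).
  by apply/rowP => i; rewrite !mxE; ring.
have tBe : t * (t * B) <= t * e.
  by rewrite ler_pM2l// -[leRHS]tB ler_pM2l//; lra.
rewrite (sqr_normvD (a - b)) normvZ exprMn real_normK ?num_real// dotvZr => H.
suff : t * (r + dotv (2 * c *: (b - a)) (w - a)) <= t * (r' + e).
  by rewrite ler_pM2l.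
rewrite dotvZl -(opprB a b) dotvNl; move: tBe; rewrite /B; lra.
Qed.

(** Moreau decomposition. Let [a] be the proximal point of [phi] at [b] with parameter [gamma], and
    [w = (b - a) / gamma]. Then [a] is a subgradient of the conjugate at [w]; adding this inequality
    at [z] to the proximal inequality for [z] at [w] cancels the linear terms and forces
    [|z - w|^2 = 0]. *)
Lemma csubdiff_of_prox_fconj {d} (phi : 'rV[R]_d -> \bar R) b z gamma :
  proper_fun phi -> convex_efun phi -> lsc_fun phi -> dom_csubdiff phi b ->
  0 < gamma -> is_prox (fconj phi) gamma^-1 (gamma^-1 *: b) z ->
  csubdiff phi (b - gamma *: z) z.
Proof.
move=> prop cvx lsc bdom gamma0 zprox; have [_ noNy] := prop.
have c0 : 0 < (2 * gamma)^-1 by rewrite invr_gt0 mulr_gt0.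
have [a amin] := prox_exists _ _ _ noNy lsc bdom c0.
have := prox_csubdiff _ _ _ _ prop cvx c0 amin.
have -> : 2 * (2 * gamma)^-1 = gamma^-1 by field; rewrite gt_eqF.
set w := gamma^-1 *: (b - a) => aw.
have bw : b - gamma *: w = a.
  by rewrite scalerA divff ?gt_eqF// scale1r opprB addrC subrK.
suff -> : z = w by rewrite bw.
have /csubdiffP[r wr wa] := csubdiff_fconj _ _ _ noNy aw.
have gamma2 : (2 * gamma^-1)^-1 = gamma / 2 by field; rewrite gt_eqF.
have [s zs] : exists s, fconj phi z = s%:E.
  have := zprox w; rewrite wr; have := fconj_noNy phi z prop.
  by case: (fconj phi z) => [s| |]// _ _; exists s.
have := zprox w; have := wa z; rewrite wr zs -!EFinD !lee_fin gamma2.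
have -> : z - gamma^-1 *: b = (w - gamma^-1 *: b) + (z - w).
  by apply/rowP => i; rewrite !mxE; ring.
have -> : a = - gamma *: (w - gamma^-1 *: b).
  rewrite -bw; apply/rowP => i; rewrite !mxE; field; by rewrite gt_eqF.
rewrite (sqr_normvD (w - _)) dotvZl => H1 H2.
have /eqP : normv (z - w) ^+ 2 = 0.
  apply/eqP; rewrite eq_le sqr_ge0 andbT.
  by rewrite -(@ler_pM2l _ gamma)// mulr0; lra.
by rewrite sqrf_eq0 => /eqP/normv_eq0/eqP; rewrite subr_eq0 => /eqP.
Qed.

(** Expanding the squares turns the proximal objective into this one, up to sign and an additive
    constant. *)
Lemma is_prox_max {d} (phi : 'rV[R]_d -> \bar R) b z w gamma r s :
  0 < gamma -> is_prox phi gamma^-1 (gamma^-1 *: b) z ->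
  phi z = r%:E -> phi w = s%:E ->
  dotv w b - s - gamma / 2 * normv w ^+ 2
    <= dotv z b - r - gamma / 2 * normv z ^+ 2.
Proof.
move=> gamma0 /(_ w) + zr ws; rewrite zr ws -!EFinD lee_fin.
have -> : (2 * gamma^-1)^-1 = gamma / 2 by field; rewrite gt_eqF.
rewrite !sqr_normvD !normvN !dotvNr !dotvZr !mulrDr !mulrN.
have E c : gamma / 2 * (2 * (gamma^-1 * c)) = c by field; rewrite gt_eqF.
by rewrite !E; lra.
Qed.

(** The points with subgradient [z] form a convex subset of the domain of the subdifferential. There
    [phi] is affine with slope [z], which contradicts strict convexity at a midpoint. *)
Lemma ess_strictly_convex_unique {d} (phi : 'rV[R]_d -> \bar R) a b z :
  (forall x, phi x != -oo%E) -> convex_efun phi -> ess_strictly_convex phi ->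
  csubdiff phi a z -> csubdiff phi b z -> a = b.
Proof.
move=> noNy cvx esc az bz; apply/eqP/negPn/negP => ab.
have /csubdiffP[r ar ra] := az; have /csubdiffP[s bs sb] := bz.
pose C : set 'rV[R]_d := [set c | csubdiff phi c z].
have Cdom : C `<=` dom_csubdiff phi by move=> c Cc; exists z.
have half : 0 < (2^-1 : R) < 1 by apply/andP; split; lra.
have Ccvx : convex_setv C.
  move=> x y t /csubdiffP[r' xr' xx] /csubdiffP[s' ys' yy] /andP[t0 t1].
  have [->|t_neq0] := eqVneq t 0.
    by rewrite scale0r subr0 scale1r add0r; apply/csubdiffP; exists s'.
  have [->|t_neq1] := eqVneq t 1.
    by rewrite scale1r subrr scale0r addr0; apply/csubdiffP; exists r'.
  have t01 : 0 < t < 1 by rewrite !lt_neqAle eq_sym t_neq0 t0 t_neq1.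
  have [c xyc cle] := convex_efun_fin _ _ _ _ _ _ cvx noNy t01 xr' ys'.
  apply/csubdiffP; exists c => // w; case wv : (phi w) (noNy w) => [v| |]// _.
    have := xx w; have := yy w; rewrite wv !lee_fin !dotvE => H1 H2.
    have {}t1 : 0 <= 1 - t by lra.
    have := ler_wpM2l t0 H2; have := ler_wpM2l t1 H1; lra.
  by rewrite leey.
have := esc C Ccvx Cdom a b 2^-1 az bz ab half; apply/negP; rewrite -leNgt.
rewrite ar bs -!EFinM -EFinD.
have [c abc _] := convex_efun_fin _ _ _ _ _ _ cvx noNy half ar bs.
rewrite abc lee_fin; have := ra b; have := sb a.
have := ra (2^-1 *: a + (1 - 2^-1) *: b).
by rewrite abc ar bs !lee_fin !dotvE; lra.
Qed.

(** On the sphere [phi - <z, .>] attains its minimum. If this did not exceed the value at [a], the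
    minimiser would be a second point with subgradient [z]. *)
Lemma csubdiff_sphere_growth {d} (phi : 'rV[R]_d -> \bar R) a z s r :
  (forall x, phi x != -oo%E) -> convex_efun phi -> lsc_fun phi ->
  ess_strictly_convex phi -> csubdiff phi a z -> phi a = s%:E -> 0 < r ->
  exists2 c, 0 < c & forall v, normv (v - a) = r ->
    ((s + dotv z (v - a) + c)%:E <= phi v)%E.
Proof.
move=> noNy cvx lsc esc az as_ r0.
pose C : set 'rV[R]_d := [set v | normv (v - a) = r].
(* The sphere may be empty, as in dimension 0. *)
have [C0|/set0P/negP/negPn/eqP C0] := pselect (C !=set0); last first.
  exists 1 => // v vr; suff : set0 v by [].
  by rewrite -C0.
pose q v := - dotv z v.
have Ccpt : compact C.
  apply: (compact_normv_preimage a [set t | t = r] r); last by move=> ? ->.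
  exact: closed_eq.
have [] := @lsc_compact_min _ _ (fun v => (phi v + (q v)%:E)%E) C _ _ Ccpt C0.
- by move=> x; case: (phi x) (noNy x).
- apply: lsc_funD => // x; exists (normv z); first exact: normv_ge0.
  by move=> y; have := dotv_le z (y - x); rewrite /q dotvDr dotvNr; lra.
move=> b Cb bmin; have := az => /csubdiffP[s']; rewrite as_ => -[<-] az'.
have [bfin|binf] := boolP (phi b \is a fin_num); last first.
  exists 1 => // v Cv; have /= := bmin v Cv.
  have -> : phi b = +oo%E by case: (phi b) (noNy b) binf.
  rewrite addye//; case: (phi v) (noNy v) => [t _|_ _|]//; last by rewrite leey.
have [t bt] : exists t, phi b = t%:E by exists (fine (phi b)); rewrite fineK.
have bgap : s + dotv z (b - a) < t.
  rewrite ltNge; apply/negP => tle.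
  have : a = b.
    apply: (ess_strictly_convex_unique _ _ _ z noNy cvx esc az).
    apply/csubdiffP; exists t => // y; apply: le_trans (az' y).
    by rewrite lee_fin; move: tle; rewrite !dotvE; lra.
  by move=> ab; move: Cb; rewrite /C /= ab subrr normv0 => /eqP; rewrite lt_eqF.
exists (t - s - dotv z (b - a)); first by lra.
move=> v Cv; have := bmin v Cv; rewrite bt.
case: (phi v) (noNy v) => [t' _|_ _|]//; last by rewrite leey.
by rewrite -!EFinD !lee_fin /q !dotvE; lra.
Qed.

(** The upper half of differentiability of the conjugate at [z]. Each affine piece, indexed by [v],
    is bounded separately: for [|v - a| < e] by Cauchy-Schwarz; farther out, the gain [c] on the
    sphere of radius [e] grows at rate [c / e] by convexity and dominates when [|w - z| < c / e]. *)
Lemma fconj_frechet_le {d} (phi : 'rV[R]_d -> \bar R) a z s :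
  (forall x, phi x != -oo%E) -> convex_efun phi -> lsc_fun phi ->
  ess_strictly_convex phi -> csubdiff phi a z -> fconj phi z = s%:E ->
  forall e, 0 < e -> exists2 r, 0 < r & forall w, normv (w - z) < r ->
    (fconj phi w <= (s + dotv a (w - z) + e * normv (w - z))%:E)%E.
Proof.
move=> noNy cvx lsc esc az zs e e0.
have /csubdiffP[f af fa] := az.
have [c c0 cP] := csubdiff_sphere_growth _ _ _ _ _ noNy cvx lsc esc az af e0.
exists (c / e); first by rewrite divr_gt0.
move=> w; rewrite ltr_pdivlMr// => wz.
move: zs; rewrite (fconj_csubdiff _ _ _ _ noNy az af) => -[<-].
apply: fconj_le => // v t vt.
suff : dotv (v - a) (w - z) <= t - f - dotv z (v - a) + e * normv (w - z).
  by rewrite !dotvE (dotvC z a) (dotvC z v); lra.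
have vat : f + dotv z (v - a) <= t by have := fa v; rewrite vt lee_fin.
have := dotv_le (v - a) (w - z).
have [va|va] := ltP (normv (v - a)) e.
  by have := ler_wpM2r (normv_ge0 (w - z)) (ltW va); lra.
suff : c * normv (v - a) <= e * (t - f - dotv z (v - a)).
  move=> H1 H2; have wz0 := normv_ge0 (w - z).
  have := ler_wpM2l (normv_ge0 (v - a)) (ltW wz) => H3.
  have : e * dotv (v - a) (w - z) <= e * (t - f - dotv z (v - a)).
    by have := ler_wpM2l (ltW e0) H2; lra.
  by rewrite ler_pM2l// => H4; have := mulr_ge0 (ltW e0) wz0; lra.
have n0 : 0 < normv (v - a) by lra.
have [vae|vae] := eqVneq (normv (v - a)) e.
  by have := cP v vae; rewrite vt lee_fin vae mulrC ler_pM2l//; lra.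
(* This [k] selects the point of the segment from [a] to [v] at distance [e] from [a]. *)
pose k := e / normv (v - a).
have kn : k * normv (v - a) = e by rewrite divfK// gt_eqF.
have k01 : 0 < k < 1.
  by rewrite divr_gt0//= ltr_pdivrMr// mul1r lt_neqAle eq_sym vae.
have [g gE gle] := convex_efun_fin _ _ _ _ _ _ cvx noNy k01 vt af.
have := cP (k *: v + (1 - k) *: a).
have -> : k *: v + (1 - k) *: a - a = k *: (v - a).
  by apply/rowP => i; rewrite !mxE; ring.
have /andP[k0 _] := k01.
rewrite normvZ gtr0_norm// kn => /(_ erefl); rewrite gE lee_fin dotvZr => H.
have : c <= k * (t - f - dotv z (v - a)) by lra.
by move=> /(ler_wpM2r (ltW n0)); rewrite mulrAC kn.
Qed.

End ConvexAnalysis.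

(** * Bounds on compact sets *)

Section CompactBounds.
Context {R : realType}.

Lemma dotv_delta {d} (y : 'rV[R]_d) i : dotv y (delta_mx 0 i) = y 0 i.
Proof.
rewrite /dotv (bigD1 i)//= mxE !eqxx mulr1 big1 ?addr0// => k ki.
by rewrite mxE (negbTE ki) andbF mulr0.
Qed.

Lemma normv_delta {d} (i : 'I_d) : normv (delta_mx 0 i : 'rV[R]_d) = 1.
Proof. by rewrite /normv dotv_delta mxE !eqxx sqrtr1. Qed.

(** Near [x0], the subgradient inequality is tested at the points [x0 K] plus or minus [r] times a
    basis vector, where [f] is at most [b]. As [f (x K) > 0], this bounds each coordinate of [y] up
    to an error [|y| D], absorbed for [x] close to [x0]. Compactness makes the bound uniform. *)
Lemma csubdiff_compact_bounded {n p} (f : 'rV[R]_p -> \bar R) (K : 'M[R]_(n, p))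
    (S : set 'rV[R]_n) :
  (forall w, f w != -oo%E) -> compact S ->
  (forall x, S x -> int_edom f (x *m K)) ->
  (forall x, S x -> (0 < f (x *m K))%E) ->
  exists2 B, 0 <= B & forall x y, S x -> csubdiff f (x *m K) y -> normv y <= B.
Proof.
move=> noNy Scpt Sint Spos.
pose P (B : R) x := S x -> forall y, csubdiff f (x *m K) y -> normv y <= B.
have [] := @compact_uniform _ _ R (fun B B' => B <= B') P S 0 _ _ _ _ Scpt.
- by [].
- by move=> ? ? ?; exact: le_trans.
- by move=> B B'; apply/orP; exact: le_total.
- by move=> B B' x BB' xB Sx y /(xB Sx) yB; exact: le_trans BB'.
- move=> x0 Sx0; have [r0 r00 r0P] := Sint _ Sx0.
  pose r := r0 / 2; have r_gt0 : 0 < r by rewrite divr_gt0.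
  have [C C0 KC] := mulmx_bounded K.
  pose b := \sum_i (`|fine (f (x0 *m K + r *: delta_mx 0 i))|
                    + `|fine (f (x0 *m K - r *: delta_mx 0 i))|).
  have fb (sg : R) i : `|sg| = 1 ->
      exists2 t, f (x0 *m K + sg *: (r *: delta_mx 0 i)) = t%:E & t <= b.
    move=> sg1; have fin : f (x0 *m K + sg *: (r *: delta_mx 0 i)) \is a fin_num.
      rewrite fin_numE noNy -ltey; apply: r0P.
      rewrite addrC addKr !normvZ sg1 normv_delta gtr0_norm// /r; lra.
    exists (fine (f (x0 *m K + sg *: (r *: delta_mx 0 i)))); first by rewrite fineK.
    apply: le_trans (ler_norm _) _; rewrite /b (bigD1 i)//=.
    have s0 : 0 <= \sum_(k | k != i) (`|fine (f (x0 *m K + r *: delta_mx 0 k))|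
        + `|fine (f (x0 *m K - r *: delta_mx 0 k))|) :> R.
      by apply: sumr_ge0 => k _; rewrite addr_ge0.
    have [->|->] : sg = 1 \/ sg = -1.
      by move: sg1; case: ger0P => _ H; [left|right]; lra.
    - rewrite scale1r -addrA lerDl addr_ge0//.
    - rewrite scaleN1r addrAC lerDr addr_ge0//.
  have Cp : 0 < 2 * (p%:R + 1) * (C + 1) :> R.
    by rewrite !mulr_gt0// ltr_wpDl.
  exists (2 * (p%:R * b) / r).
  (* This radius ensures [p D <= r / 2], so that half of [r |y|] survives the absorption. *)
  exists (r / (2 * (p%:R + 1) * (C + 1))); first by rewrite divr_gt0.
  move=> x; rewrite ltr_pdivlMr// => xx0 Sx y /csubdiffP[c xc cy].
  have c0 : 0 < c by have := Spos _ Sx; rewrite xc.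
  set D := normv (x0 *m K - x *m K).
  have DC : D <= C * normv (x - x0).
    by rewrite /D normvBC -mulmxBl KC.
  have pD : p%:R * D <= r / 2.
    have p0 : 0 <= p%:R :> R by [].
    have := ler_wpM2l p0 DC; have := normv_ge0 (x - x0); set N := normv (x - x0).
    move=> N0 H; have := mulr_ge0 p0 N0; have := mulr_ge0 C0 N0.
    by move: xx0; rewrite -/N; lra.
  have coord i : r * `|y 0 i| <= b + normv y * D.
    have Hs sg : `|sg| = 1 -> sg * (r * y 0 i) <= b + normv y * D.
      move=> /(fb sg i)[t ft tb]; have := cy (x0 *m K + sg *: (r *: delta_mx 0 i)).
      rewrite ft lee_fin addrAC dotvDr 2!dotvZr dotv_delta.
      have := dotv_le_normv y (x0 *m K - x *m K); rewrite ler_norml => /andP[+ _].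
      by rewrite -/D; lra.
    have := Hs 1 (normr1 _); have := Hs (-1) (normrN1 _).
    by case: (ger0P (y 0 i)) => _; lra.
  have : r * normv y <= p%:R * (b + normv y * D).
    apply: le_trans (_ : r * \sum_i `|y 0 i| <= _).
      by rewrite ler_pM2l// normv_le_sum.
    rewrite mulr_sumr mulr_natl -[X in _ *+ X]card_ord -sumr_const.
    by apply: ler_sum => i _; exact: coord.
  have := ler_wpM2l (normv_ge0 y) pD.
  by rewrite ler_pdivlMr//; lra.
move=> B BP; exists `|B| => // x y Sx xy.
by apply: le_trans (ler_norm _); exact: (BP x Sx Sx y xy).
Qed.

(** Mean value theorem for [h] restricted to the segment from [a] to [b]. *)
Lemma gradient_lipschitz {n} (h : 'rV[R]_n -> R) (gradh : 'rV[R]_n -> 'rV[R]_n)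
    (U : set 'rV[R]_n) (a b : 'rV[R]_n) G :
  is_gradient_on h gradh U ->
  (forall t, 0 <= t <= 1 -> U (a + t *: (b - a))) ->
  (forall t, 0 <= t <= 1 -> normv (gradh (a + t *: (b - a))) <= G) ->
  `|h b - h a| <= G * normv (b - a).
Proof.
move=> hgrad Uab gradG.
pose phi t := h (a + t *: (b - a)).
pose dphi t := dotv (gradh (a + t *: (b - a))) (b - a).
have drv (t : R) : 0 <= t <= 1 -> is_derive t 1 phi (dphi t).
  move=> t01.
  have cv : (fun s => s^-1 *: (phi (s *: 1 + t) - phi t)) @ 0^' --> dphi t.
    apply/cvgrPdist_le => e e0.
    (* The [+ 1] covers the case [a = b]. *)
    have n1 : 0 < normv (b - a) + 1 by rewrite ltr_wpDl// normv_ge0.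
    have e1 : 0 < e / (normv (b - a) + 1) by rewrite divr_gt0.
    have [r r0 rP] := hgrad _ (Uab t t01) _ e1.
    have r1 : 0 < r / (normv (b - a) + 1) by rewrite divr_gt0.
    exists (r / (normv (b - a) + 1)) => //= s /=.
    rewrite sub0r normrN ltr_pdivlMr// => sr s0.
    have := rP (a + (s *: 1 + t) *: (b - a)).
    have -> : a + (s *: 1 + t) *: (b - a) - (a + t *: (b - a)) = s *: (b - a).
      by rewrite [s *: _]mulr1; apply/rowP => i; rewrite !mxE; ring.
    rewrite normvZ dotvZr -/(phi t) -/(phi _) -/(dphi t) => H.
    have n0 := normv_ge0 (b - a).
    have s_gt0 : 0 < `|s| by rewrite normr_gt0.
    rewrite -(ler_pM2l s_gt0) -normrM mulrBr.
    have -> : s * (s^-1 *: (phi (s *: 1 + t) - phi t)) = phi (s *: 1 + t) - phi t.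
      by rewrite [_ *: _]/(_ * _) mulrA divff// mul1r.
    rewrite distrC; apply: le_trans (H _) _; first by lra.
    rewrite mulrCA ler_pM2l// -mulrA.
    by rewrite ger_pMr// mulrC ler_pdivrMr// mul1r lerDl.
  apply: DeriveDef; first by apply: cvgP cv.
  by rewrite /derive; exact: cvg_lim.
have [||c c01] := @MVT_segment R phi dphi 0 1 ler01 _ _.
- by move=> t /itvP t01; apply: drv; rewrite !t01.
- apply: derivable_within_continuous => t /itvP t01.
  by have [] := drv t (_ : 0 <= t <= 1); rewrite ?t01.
rewrite subr0 mulr1 /phi /dphi scale1r scale0r addr0 (addrC a (b - a)) subrK => ->.
apply: le_trans (dotv_le_normv _ _) _.
by rewrite ler_wpM2r ?normv_ge0// gradG// !(itvP c01).
Qed.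

End CompactBounds.

(** * A subgradient of the fractional objective *)

Section FractionalObjective.
Context {R : realType}.

Lemma dotv_tr_mulmx {a b} (w : 'rV[R]_b) (B : 'M[R]_(a, b)) (x : 'rV[R]_a) :
  dotv (w *m B^T) x = dotv w (x *m B).
Proof. by rewrite dotvC -dotv_mulmx dotvC. Qed.

Lemma Psi_fin {n s} (g : 'rV[R]_s -> \bar R) (h : 'rV[R]_n -> R)
    (A : 'M[R]_(n, s)) (S : set 'rV[R]_n) x z u delta gamma G :
  S x -> fconj g z = G%:E ->
  Psi g h A S x z u delta gamma
  = (dotv z (x *m A) - G + h x + delta / 2 * normv (x - u) ^+ 2
     - gamma / 2 * normv z ^+ 2)%:E.
Proof.
by move=> Sx zG; rewrite /Psi zG /Defs.iota asboolT//= addr0.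
Qed.

Lemma Psi_notin {n s} (g : 'rV[R]_s -> \bar R) (h : 'rV[R]_n -> R)
    (A : 'M[R]_(n, s)) (S : set 'rV[R]_n) x z u delta gamma G :
  ~ S x -> fconj g z = G%:E -> Psi g h A S x z u delta gamma = +oo%E.
Proof. by move=> Sx zG; rewrite /Psi zG /Defs.iota asboolF. Qed.

(** Write [N / D = Nb / Db + (N - (Nb / Db) D) / D]. Replacing [1 / D] by [1 / Db] in front of [pi]
    costs [|pi| |D - Db| / (D Db)], which is of second order in [T]. *)
Lemma quotient_lower_bound (N D Nb Db m pi P c e T : R) :
  0 < m -> m / 2 < D -> m / 2 < Db -> 0 <= T -> 0 <= e -> 0 <= c -> 0 <= P ->
  `|pi| <= P * T -> `|D - Db| <= c * T ->
  pi - e * T <= N - Nb / Db * D ->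
  Nb / Db + Db^-1 * pi - (2 / m * e + (2 / m) ^+ 2 * P * c * T) * T <= N / D.
Proof.
move=> m0 mD mDb T0 e0 c0 P0 piP Dc H.
have D0 : 0 < D by lra.
have Db0 : 0 < Db by lra.
have -> : N / D = Nb / Db + (N - Nb / Db * D) / D by field; rewrite !gt_eqF.
have inv_le (t : R) : m / 2 < t -> 0 <= t^-1 <= 2 / m.
  move=> mt; have t0 : 0 < t by lra.
  rewrite invr_ge0 ltW//= -(invf_div m 2) lef_pV2 ?posrE ?ltW//.
  by rewrite divr_gt0.
have /andP[i0 ik] := inv_le _ mD; have /andP[j0 jk] := inv_le _ mDb.
set k := 2 / m in ik jk *.
have k0 : 0 <= k by apply: le_trans ik.
have step1 : (pi - e * T) * D^-1 <= (N - Nb / Db * D) / D.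
  by rewrite ler_wpM2r.
have step2 : e * T * D^-1 <= e * T * k by rewrite ler_wpM2l// mulr_ge0.
have split : pi * D^-1 = pi * Db^-1 - pi * (D - Db) * (D^-1 * Db^-1).
  by field; rewrite !gt_eqF.
have step3 : pi * (D - Db) * (D^-1 * Db^-1) <= P * T * (c * T) * (k * k).
  apply: le_trans (ler_norm _) _; rewrite !normrM.
  rewrite (ger0_norm i0) (ger0_norm j0).
  by apply: ler_pM; rewrite ?mulr_ge0// ler_pM.
by rewrite expr2; lra.
Qed.

Lemma pt4_surj {n p s} (w : 'rV[R]_(n + p + s + n)) :
  exists x y z u, w = pt4 x y z u.
Proof.
exists (lsubmx (lsubmx (lsubmx w))), (rsubmx (lsubmx (lsubmx w))).
by exists (rsubmx (lsubmx w)), (rsubmx w); rewrite /pt4 !hsubmxK.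
Qed.

Lemma pt4B {n p s} (x x' : 'rV[R]_n) (y y' : 'rV[R]_p)
    (z z' : 'rV[R]_s) (u u' : 'rV[R]_n) :
  pt4 x y z u - pt4 x' y' z' u' = pt4 (x - x') (y - y') (z - z') (u - u').
Proof. by rewrite /pt4 !opp_row_mx !add_row_mx. Qed.

Lemma dotv_pt4 {n p s} (x x' : 'rV[R]_n) (y y' : 'rV[R]_p)
    (z z' : 'rV[R]_s) (u u' : 'rV[R]_n) :
  dotv (pt4 x y z u) (pt4 x' y' z' u')
  = dotv x x' + dotv y y' + dotv z z' + dotv u u'.
Proof. by rewrite /pt4 !dotv_row_mx. Qed.

Lemma normv_pt4 {n p s} (x : 'rV[R]_n) (y : 'rV[R]_p)
    (z : 'rV[R]_s) (u : 'rV[R]_n) :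
  normv (pt4 x y z u) <= normv x + normv y + normv z + normv u.
Proof.
have := normv_row_mx x y; have := normv_row_mx (row_mx x y) z.
by have := normv_row_mx (row_mx (row_mx x y) z) u; rewrite /pt4; lra.
Qed.

Lemma normv_pt4_ge {n p s} (x : 'rV[R]_n) (y : 'rV[R]_p)
    (z : 'rV[R]_s) (u : 'rV[R]_n) :
  [/\ normv x <= normv (pt4 x y z u), normv y <= normv (pt4 x y z u),
      normv z <= normv (pt4 x y z u) & normv u <= normv (pt4 x y z u)].
Proof.
have [h1 h2] := normv_row_mx_ge (row_mx (row_mx x y) z) u.
have [h3 h4] := normv_row_mx_ge (row_mx x y) z.
have [h5 h6] := normv_row_mx_ge x y.
by split=> //; rewrite /pt4; lra.
Qed.

Section FrechetSubgradient.
Context {n p s : nat} (f : 'rV[R]_p -> \bar R) (g : 'rV[R]_s -> \bar R).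
Context (h : 'rV[R]_n -> R) (A : 'M[R]_(n, s)) (K : 'M[R]_(n, p)).
Context (S : set 'rV[R]_n) (m delta gamma : R).

Lemma Gamma_fin x y z u F G :
  0 < m -> S x -> fconj f y = F%:E -> fconj g z = G%:E ->
  m / 2 < dotv (x *m K) y - F ->
  Gamma f g h A K S m delta gamma x y z u =
  ((dotv z (x *m A) - G + h x + delta / 2 * normv (x - u) ^+ 2
     - gamma / 2 * normv z ^+ 2) / (dotv (x *m K) y - F))%:E.
Proof.
move=> m0 Sx yF zG mD; rewrite /Gamma yF -EFinB asboolT.
  by rewrite (Psi_fin _ _ _ _ _ _ _ _ _ _ Sx zG).
by split; rewrite /edom /= ?yF ?zG ?ltry ?lte_fin.
Qed.

(** Wherever one of the constraints fails the value is [+oo], so a lower bound only has to be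
    checked on finite data. *)
Lemma Gamma_ge x y z u (c : R) :
  0 < m -> (forall y, fconj f y != -oo%E) -> (forall z, fconj g z != -oo%E) ->
  (forall F G, S x -> fconj f y = F%:E -> fconj g z = G%:E ->
     m / 2 < dotv (x *m K) y - F ->
     c <= (dotv z (x *m A) - G + h x + delta / 2 * normv (x - u) ^+ 2
       - gamma / 2 * normv z ^+ 2) / (dotv (x *m K) y - F)) ->
  (c%:E <= Gamma f g h A K S m delta gamma x y z u)%E.
Proof.
move=> m0 fN gN H; rewrite /Gamma.
case: asboolP => [[ydom mD zdom]|_]; last by rewrite leey.
move: ydom mD zdom; rewrite /edom /=.
case yF : (fconj f y) (fN y) => [F| |]// _ _; rewrite -EFinB lte_fin /= => mD.
case zG : (fconj g z) (gN z) => [G| |]// _ _.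
have D0 : 0 < dotv (x *m K) y - F by lra.
have [Sx|Sx] := pselect (S x).
  by rewrite (Psi_fin _ _ _ _ _ _ _ _ _ _ Sx zG) lee_fin; exact: H.
by rewrite (Psi_notin _ _ _ _ _ _ _ _ _ _ Sx zG) gt0_mulye ?leey// lte_fin invr_gt0.
Qed.

Lemma Gamma_vec_pt4 x y z u :
  Gamma_vec f g h A K S m delta gamma (pt4 x y z u)
  = Gamma f g h A K S m delta gamma x y z u.
Proof. by rewrite /Gamma_vec /pt4 !(row_mxKl, row_mxKr). Qed.

Context (x : 'rV[R]_n) (y : 'rV[R]_p) (z : 'rV[R]_s) (u : 'rV[R]_n) (F G : R).
Context (xi : 'rV[R]_p) (a : 'rV[R]_s) (dh nv : 'rV[R]_n).
Let N := dotv z (x *m A) - G + h x + delta / 2 * normv (x - u) ^+ 2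
         - gamma / 2 * normv z ^+ 2.
Let D := dotv (x *m K) y - F.
Let Q := N / D.

(** Candidate subgradient of [N - Q D]: [xi] stands for a subgradient of the conjugate of [f] at
    [y], [a] for the gradient of that of [g] at [z], [dh] for the gradient of [h] and [nv] for a
    normal vector to [S] at [x]. *)
Let v := pt4 (z *m A^T + dh + delta *: (x - u) + nv - Q *: (y *m K^T))
             (Q *: (xi - x *m K)) (x *m A - a - gamma *: z) (delta *: (u - x)).

(** The constant part [N - Q D] vanishes and the convex square is bounded below by its
    linearisation. What remains beyond first order is [<dz, dx A>], [Q <dx K, dy>] and
    [gamma / 2 |dz|^2], all at most a multiple of [T^2]; the two [e] come from [g^*] and [h]. *)
Lemma Gamma_numerator_expansion CA CK e :
  0 < D -> 0 <= Q -> 0 <= delta -> 0 <= gamma -> 0 <= e -> 0 <= CA -> 0 <= CK ->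
  (forall w, normv (w *m A) <= CA * normv w) ->
  (forall w, normv (w *m K) <= CK * normv w) ->
  forall dx dy dz du F' G' T,
  normv dx <= T -> normv dy <= T -> normv dz <= T -> 0 <= T ->
  F + dotv xi dy <= F' ->
  G' <= G + dotv a dz + e * normv dz ->
  h x + dotv dh dx - e * normv dx <= h (x + dx) ->
  dotv nv dx <= 0 ->
  dotv v (pt4 dx dy dz du) - (2 * e + (CA + gamma / 2 + Q * CK) * T) * T
  <= dotv (z + dz) ((x + dx) *m A) - G' + h (x + dx)
     + delta / 2 * normv (x + dx - (u + du)) ^+ 2
     - gamma / 2 * normv (z + dz) ^+ 2
     - Q * (dotv ((x + dx) *m K) (y + dy) - F').
Proof.
move=> D0 Q0 d0 g0 e0 CA0 CK0 HA HK dx dy dz du F' G' T xT yT zT T0 HF HG Hh Hn.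
have HNQ : N - Q * D = 0 by rewrite divfK ?subrr// gt_eqF.
have nx := normv_ge0 dx; have ny := normv_ge0 dy; have nz := normv_ge0 dz.
have bA : - (CA * (T * T)) <= dotv dz (dx *m A).
  have := dotv_le_normv dz (dx *m A); rewrite ler_norml => /andP[+ _].
  apply: le_trans; rewrite lerN2 mulrCA ler_pM ?normv_ge0//.
  by apply: le_trans (HA dx) _; rewrite ler_wpM2l.
have bK : dotv (dx *m K) dy <= CK * (T * T).
  apply: le_trans (dotv_le _ _) _; rewrite mulrA ler_pM ?normv_ge0//.
  by apply: le_trans (HK dx) _; rewrite ler_wpM2l.
have bz : normv dz ^+ 2 <= T * T by rewrite -expr2 ler_sqr ?nnegrE.
have sq := sqr_normv_ge (x - u) (x + dx - (u + du)).
have {}sq : normv (x - u) ^+ 2 + 2 * dotv (x - u) (dx - du)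
    <= normv (x + dx - (u + du)) ^+ 2.
  by move: sq; congr (_ + 2 * dotv _ _ <= _); apply/rowP => i; rewrite !mxE; ring.
have {}sq := ler_wpM2l d0 sq.
have {}HF := ler_wpM2l Q0 HF.
have {}bK := ler_wpM2l Q0 bK.
have {}bz := ler_wpM2l g0 bz.
have ex := ler_wpM2l e0 xT; have ez := ler_wpM2l e0 zT.
rewrite dotv_pt4 !mulmxDl (sqr_normvD z) !dotvE.
move: HNQ sq; rewrite !dotvE !dotv_tr_mulmx (dotvC (x *m K) dy) (dotvC (x *m A) dz).
rewrite /N /D (dotvC y (dx *m K)); lra.
Qed.

(** The expansion bounds [N' - Q D'] from below, calmness bounds [|D' - D|] linearly, and
    [quotient_lower_bound] passes to the quotient. *)
Lemma Gamma_vec_frechet_subdiff :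
  (forall w, fconj f w != -oo%E) -> (forall w, fconj g w != -oo%E) ->
  0 < m -> m / 2 < D -> 0 <= N -> 0 <= delta -> 0 <= gamma ->
  S x -> fconj f y = F%:E -> fconj g z = G%:E ->
  calm_at (fconj f) y -> csubdiff (fconj f) y xi ->
  (forall e, 0 < e -> exists2 r, 0 < r & forall w, normv (w - z) < r ->
    (fconj g w <= (G + dotv a (w - z) + e * normv (w - z))%:E)%E) ->
  (forall e, 0 < e -> exists2 r, 0 < r & forall w, normv (w - x) < r ->
    `| h w - h x - dotv dh (w - x) | <= e * normv (w - x)) ->
  (forall w, S w -> dotv nv (w - x) <= 0) ->
  frechet_subdiff (Gamma_vec f g h A K S m delta gamma) (pt4 x y z u) (D^-1 *: v).
Proof.
move=> fN gN m0 mD N0 d0 g0 Sx yF zG.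
move=> [rc [kap [rc0 [kap0 calm]]]] /csubdiffP[F'' + xiF].
rewrite yF => -[E]; move: xiF; rewrite -{}E => xiF Hg Hh Hnv.
have [CA CA0 HA] := mulmx_bounded A; have [CK CK0 HK] := mulmx_bounded K.
have D0 : 0 < D by lra.
have Q0 : 0 <= Q by rewrite divr_ge0// ltW.
have fin0 : Gamma_vec f g h A K S m delta gamma (pt4 x y z u) = Q%:E.
  by rewrite Gamma_vec_pt4 (Gamma_fin _ _ _ _ _ _ m0 Sx yF zG mD).
split; first by rewrite fin0.
move=> e e0; pose k := 2 / m.
have k0 : 0 < k by rewrite divr_gt0.
(* Half of [e] pays for the first-order error, as [k (2 e1) = e / 2]; the other half pays for the
   second-order term [W T]. *)
pose e1 := e / (4 * k).
have e10 : 0 < e1 by rewrite divr_gt0// mulr_gt0.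
have [rg rg0 {}Hg] := Hg _ e10; have [rh rh0 {}Hh] := Hh _ e10.
pose c := CK * normv y + CK * normv x + CK + kap.
have c0 : 0 <= c by rewrite !addr_ge0 ?mulr_ge0 ?normv_ge0// ltW.
pose B := CA + gamma / 2 + Q * CK.
have B0 : 0 <= B by have := mulr_ge0 Q0 CK0; rewrite /B; lra.
pose W := k * B + k ^+ 2 * normv v * c.
have W0 : 0 <= W.
  apply: addr_ge0; first exact: mulr_ge0 (ltW k0) B0.
  by rewrite mulr_ge0// mulr_ge0 ?sqr_ge0 ?normv_ge0.
have W1 : 0 < W + 1 by lra.
exists (Num.min (Num.min rg rh) (Num.min (Num.min rc 1) (e / 2 / (W + 1)))).
  by rewrite !lt_min rg0 rh0 rc0 ltr01 !divr_gt0.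
move=> w; have [x' [y' [z' [u' ->]]]] := pt4_surj w.
rewrite fin0 Gamma_vec_pt4 pt4B.
have [xT yT zT _] := normv_pt4_ge (x' - x) (y' - y) (z' - z) (u' - u).
set del := pt4 _ _ _ _ in xT yT zT *; set T := normv del in xT yT zT *.
have T0 : 0 <= T := normv_ge0 _.
rewrite !lt_min ltr_pdivlMr// => /andP[/andP[Tg Th] /andP[/andP[Tc T1] TW]].
apply: Gamma_ge => // F' G' Sx' y'F z'G mD'.
set N' := (X in X / _); set D' := (X in _ / X).
have Dc : `|D' - D| <= c * T.
  have := calm (y' - y + y); rewrite subrK => /(_ (le_lt_trans yT Tc)).
  rewrite y'F yF lee_fin => HF.
  have -> : D' - D = dotv ((x' - x) *m K) y + dotv (x *m K) (y' - y)
      + dotv ((x' - x) *m K) (y' - y) - (F' - F).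
    by rewrite /D' /D !mulmxBl !dotvE; ring.
  have b1 : `|dotv ((x' - x) *m K) y| <= CK * T * normv y.
    apply: le_trans (dotv_le_normv _ _) _; rewrite ler_wpM2r ?normv_ge0//.
    by apply: le_trans (HK _) _; rewrite ler_wpM2l.
  have b2 : `|dotv (x *m K) (y' - y)| <= CK * normv x * T.
    by apply: le_trans (dotv_le_normv _ _) _; rewrite ler_pM ?normv_ge0.
  have b3 : `|dotv ((x' - x) *m K) (y' - y)| <= CK * T * 1.
    apply: le_trans (dotv_le_normv _ _) _; rewrite ler_pM ?normv_ge0//; last by lra.
    by apply: le_trans (HK _) _; rewrite ler_wpM2l.
  have b4 : `|F' - F| <= kap * T.
    by apply: le_trans HF _; rewrite ler_wpM2l// ltW.
  apply: le_trans (ler_normB _ _) _.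
  apply: le_trans (lerD (ler_normD _ _) (lexx _)) _.
  apply: le_trans (lerD (lerD (ler_normD _ _) (lexx _)) (lexx _)) _.
  by rewrite /c; lra.
have num : dotv v del - (2 * e1 + B * T) * T <= N' - Q * D'.
  have := Gamma_numerator_expansion CA CK e1 D0 Q0 d0 g0 (ltW e10) CA0 CK0 HA HK
    (x' - x) (y' - y) (z' - z) (u' - u) F' G' T xT yT zT T0.
  rewrite !(addrC x) !(addrC y) !(addrC z) !(addrC u) !subrK; apply.
  - by have := xiF y'; rewrite y'F lee_fin.
  - by have := Hg z' (le_lt_trans zT Tg); rewrite z'G lee_fin.
  - have := Hh x' (le_lt_trans xT Th); rewrite ler_norml => /andP[+ _]; lra.
  - exact: Hnv.
have := quotient_lower_bound N' D' N D m (dotv v del) (normv v) c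
  (2 * e1 + B * T) T m0 mD' mD T0 _ c0 (normv_ge0 _) (dotv_le_normv _ _) Dc num.
rewrite -/Q -/k dotvZl => H.
apply: le_trans (H _); last first.
  by have := mulr_ge0 B0 T0; lra.
rewrite -addrA lerD2l lerD2l lerN2 ler_wpM2r//.
have ke : k * (2 * e1) = e / 2 by rewrite /e1; field; rewrite gt_eqF.
rewrite mulrDr ke; move: TW; rewrite /W; lra.
Qed.

End FrechetSubgradient.
End FractionalObjective.

(** * The iteration *)

Section Iteration.
Context {R : realType}.

Lemma dist0_le {d} (V : set 'rV[R]_d) v c :
  V v -> normv v <= c -> (dist0 V <= c%:E)%E.
Proof.
move=> Vv vc; apply: le_trans (_ : (normv v)%:E <= _)%E; last by rewrite lee_fin.
by apply: ereal_inf_lbound; exists v.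
Qed.

Lemma frechet_limiting_subdiff {d} (phi : 'rV[R]_d -> \bar R) x :
  frechet_subdiff phi x `<=` limiting_subdiff phi x.
Proof.
move=> v xv; exists (fun=> x), (fun=> v); split.
- by move=> e e0; exists 0%N => k _; rewrite subrr normv0.
- by move=> e e0; exists 0%N => k _; rewrite subrr normv0.
- by case: xv.
- by move=> e e0; exists 0%N => k _; rewrite subrr normr0.
- by [].
Qed.

(** Variational inequality of the projection: compare [x] with [t y + (1 - t) x], where [t] is small
    enough that [t B <= e]. *)
Lemma is_proj_normal {d} (S : set 'rV[R]_d) w x :
  convex_setv S -> is_proj S w x -> forall y, S y -> dotv (w - x) (y - x) <= 0.
Proof.
move=> cvx [Sx xmin] y Sy; apply/ler_addgt0Pr => e e0; rewrite add0r.
set B := normv (y - x) ^+ 2.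
have B0 : 0 <= B := sqr_ge0 _.
have B1 : 0 < B + e + 1 by lra.
pose t := e / (B + e + 1).
have t0 : 0 < t by rewrite divr_gt0.
have tB : t * (B + e + 1) = e by rewrite divfK// gt_eqF.
have t01 : 0 <= t <= 1 by rewrite ltW//= ler_pdivrMr//; lra.
have := xmin _ (cvx _ _ t Sy Sx t01).
have -> : w - (t *: y + (1 - t) *: x) = (w - x) + - t *: (y - x).
  by apply/rowP => i; rewrite !mxE; ring.
rewrite -ler_sqr ?nnegrE ?normv_ge0// (sqr_normvD (w - x)) dotvZr normvZ exprMn.
rewrite real_normK ?num_real// sqrrN -/B => H.
have te : t * B <= e by rewrite -[leRHS]tB ler_pM2l//; lra.
have : t * (2 * dotv (w - x) (y - x)) <= t * e.
  by have := ler_wpM2l (ltW t0) te; lra.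
by rewrite ler_pM2l//; lra.
Qed.

(** The factor [r = |1 - beta|] is below 1, and [c] is the fixed point of [t -> r t + beta B]. *)
Lemma relaxation_bounded {d} (x u : nat -> 'rV[R]_d) beta B :
  0 < beta < 2 -> 0 <= B -> (forall k, normv (x k.+1) <= B) ->
  (forall k, u k.+1 = (1 - beta) *: u k + beta *: x k.+1) ->
  exists2 C, 0 <= C & forall k, normv (u k) <= C.
Proof.
move=> /andP[b0 b2] B0 xB uE; set r := `|1 - beta|.
have r1 : r < 1 by rewrite /r ltr_norml; apply/andP; split; lra.
have r0 : 0 <= r := normr_ge0 _.
pose c := beta * B / (1 - r).
have cE : c * (1 - r) = beta * B by rewrite divfK// gt_eqF// subr_gt0.
have c0 : 0 <= c.
  by apply: divr_ge0; [exact: mulr_ge0 (ltW b0) B0|lra].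
have C0 : 0 <= normv (u 0%N) + c := addr_ge0 (normv_ge0 _) c0.
exists (normv (u 0%N) + c) => //; elim=> [|k IH]; first by rewrite lerDl.
rewrite uE; apply: le_trans (ler_normvD _ _) _; rewrite !normvZ (gtr0_norm b0) -/r.
have := ler_wpM2l r0 IH; have := ler_wpM2l (ltW b0) (xB k).
have r1' : 0 <= 1 - r by lra.
have := mulr_ge0 r1' (normv_ge0 (u 0%N)); lra.
Qed.

(** When [gamma_] does not change, the final reduction by [q] cannot have occurred, since it would
    make the new value strictly smaller. Hence the accepted trial parameter is [gamma] itself. *)
Lemma alg_iterates_step {n p s} {S : set 'rV[R]_n} {A : 'M[R]_(n, s)}
  {K : 'M[R]_(n, p)} {f g h gradh L beta nu q delta0 theta0 eps}
  {x u : nat -> 'rV[R]_n} {z : nat -> 'rV[R]_s} {y : nat -> 'rV[R]_p}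
  {theta delta gamma_ : nat -> R} {j : nat -> nat} {gamma} k :
  alg_iterates S A K f g h gradh L beta nu q delta0 theta0 eps
            x u z y theta delta gamma_ j ->
  0 < q < 1 -> 0 < gamma -> gamma_ k = gamma -> gamma_ k.+1 = gamma ->
  [/\ is_prox (fconj g) gamma^-1 (gamma^-1 *: (x k.+1 *m A)) (z k.+1),
      (theta k.+1)%:E = (Psi g h A S (x k.+1) (z k.+1) (u k.+1) (delta k) gamma
                         * ((fine (f (x k.+1 *m K)))^-1)%:E)%E
    & 0 < theta k.+1].
Proof.
move=> [_ _ _ /(_ k)] /= [_ _ _ [_ prox th th0] [gE _]] /andP[q0 q1] gamma0 gk gk1.
suff E : gamma_ k * q ^+ j k = gamma by move: prox th; rewrite E.
move: gE; rewrite gk1; case: ifP => // _ E.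
have : gamma * (q ^+ j k * q) < gamma.
  rewrite gtr_pMr//; apply: le_lt_trans (q1); rewrite ger_pMl//.
  exact: exprn_ile1 (ltW q0) (ltW q1).
by move: E; rewrite gk -mulrA => <-; rewrite ltxx.
Qed.

(* The maximum over [z] in the numerator is attained at the proximal point, so
   [g^*] drops out of the comparison of two values. *)
Lemma value_prox_lipschitz {n s} (A : 'M[R]_(n, s)) (phi : 'rV[R]_s -> \bar R)
  (h : 'rV[R]_n -> R) x x' u u' z z' G G' gamma delta C Bz Lh B :
  0 < gamma -> 0 <= delta -> 0 <= C -> 0 <= Lh ->
  (forall w, normv (w *m A) <= C * normv w) ->
  is_prox phi gamma^-1 (gamma^-1 *: (x' *m A)) z' ->
  phi z = G%:E -> phi z' = G'%:E ->
  normv z <= Bz -> `|h x - h x'| <= Lh * normv (x - x') ->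
  normv (x - u) <= B -> normv (x' - u') <= B ->
  (dotv z (x *m A) - G + h x + delta / 2 * normv (x - u) ^+ 2
     - gamma / 2 * normv z ^+ 2)
  - (dotv z' (x' *m A) - G' + h x' + delta / 2 * normv (x' - u') ^+ 2
     - gamma / 2 * normv z' ^+ 2)
  <= (Bz * C + Lh + delta * B) * (normv (x - x') + normv (u - u')).
Proof.
move=> g0 d0 C0 Lh0 HC prox zG zG' zB hL uB uB'.
have := is_prox_max _ _ _ _ _ _ _ g0 prox zG' zG.
have := dotv_le z ((x - x') *m A); rewrite mulmxBl dotvDr dotvNr -mulmxBl.
have dx0 := normv_ge0 (x - x'); have du0 := normv_ge0 (u - u').
have Bz0 : 0 <= Bz := le_trans (normv_ge0 _) zB.
have B0 : 0 <= B := le_trans (normv_ge0 _) uB.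
have H1 : normv z * normv ((x - x') *m A) <= Bz * (C * normv (x - x')).
  by rewrite ler_pM ?normv_ge0.
have H2 : h x - h x' <= Lh * normv (x - x') := le_trans (ler_norm _) hL.
have H3 : normv (x - u) ^+ 2 - normv (x' - u') ^+ 2
    <= 2 * B * (normv (x - x') + normv (u - u')).
  rewrite subr_sqr mulrC; apply: le_trans (ler_norm _) _; rewrite normrM.
  apply: ler_pM => //.
    by rewrite ger0_norm ?addr_ge0 ?normv_ge0//; lra.
  apply: le_trans (ler_dist_normv _ _) _.
  have -> : x - u - (x' - u') = (x - x') - (u - u').
    by apply/rowP => i; rewrite !mxE; ring.
  exact: ler_normvB.
have {}H3 := ler_wpM2l d0 H3.
have := mulr_ge0 (mulr_ge0 Bz0 C0) du0.
have := mulr_ge0 Lh0 du0; lra.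
Qed.

End Iteration.

(** * Comparison of quotients and cancellation in the [x]-block *)

Section Estimates.
Context {R : realType}.

Lemma quotient_diff_le (N N' c D m B E1 E2 : R) :
  0 < m -> m <= c -> m <= D -> `|N| <= B -> `|N - N'| <= E1 -> `|D - c| <= E2 ->
  `|N / c - N' / D| <= E1 / m + B * E2 / m ^+ 2.
Proof.
move=> m0 mc mD NB NE DE.
have c0 : 0 < c by lra.
have D0 : 0 < D by lra.
have -> : N / c - N' / D = (N - N') * D^-1 + N * (D - c) * (c^-1 * D^-1).
  by field; rewrite !gt_eqF.
have cm : c^-1 <= m^-1 by rewrite lef_pV2.
have Dm : D^-1 <= m^-1 by rewrite lef_pV2.
have ci : 0 <= c^-1 by rewrite invr_ge0 ltW.
have Di : 0 <= D^-1 by rewrite invr_ge0 ltW.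
apply: le_trans (ler_normD _ _) _; rewrite !normrM (ger0_norm ci) (ger0_norm Di).
apply: lerD; first exact: ler_pM.
by rewrite -exprVn expr2; apply: ler_pM => //; rewrite ?mulr_ge0//; apply: ler_pM.
Qed.

(* The projection residual cancels the non-vanishing terms of the [x]-block. *)
Lemma x_block_eq {n p s} (A : 'M[R]_(n, s)) (K : 'M[R]_(n, p))
    (x' u u' dh dh' : 'rV[R]_n) (z z' : 'rV[R]_s) (y : 'rV[R]_p) delta theta Q :
  delta != 0 ->
  z' *m A^T + dh' + delta *: (x' - u')
    + delta *: (u + (theta / delta) *: (y *m K^T) - delta^-1 *: dh
                - delta^-1 *: (z *m A^T) - x')
    - Q *: (y *m K^T)
  = (z' - z) *m A^T + (dh' - dh) + delta *: (u - u') + (theta - Q) *: (y *m K^T).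
Proof.
move=> d0; rewrite mulmxBl; set Y := y *m _; set Z := z *m _; set Z' := z' *m _.
by apply/rowP => i; rewrite !mxE; field.
Qed.

End Estimates.

Theorem theorem6p2 (R : realType) (n s p : nat)
  (S : set 'rV[R]_n) (A : 'M[R]_(n, s)) (K : 'M[R]_(n, p))
  (g : 'rV[R]_s -> \bar R) (h : 'rV[R]_n -> R) (f : 'rV[R]_p -> \bar R)
  (U : set 'rV[R]_n) (gradh : 'rV[R]_n -> 'rV[R]_n) (L : R) (ell : R)
  (* standing assumptions *)
  (HS0 : S !=set0) (HSconv : convex_setv S) (HScomp : compact S)
  (Hg : proper_fun g /\ convex_efun g /\ lsc_fun g)
  (HU : open U) (HSU : S `<=` U) (Hgrad : is_gradient_on h gradh U)
  (HL0 : 0 <= L)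
  (HLip : forall a b, U a -> U b -> normv (gradh a - gradh b) <= L * normv (a - b))
  (Hf : proper_fun f /\ convex_efun f /\ lsc_fun f)
  (HKS : forall x, S x -> int_edom f (x *m K))
  (HfKpos : forall x, S x -> (0 < f (x *m K))%E)
  (HSAg : exists2 x, S x & edom g (x *m A))
  (Hinf : (0 < ereal_inf [set (g (x *m A) + (h x)%:E)%E | x in S])%E)
  (HASdom : forall x, S x -> dom_csubdiff g (x *m A))
  (Hell : 0 < ell) (Hellb : forall x, S x -> (dist0 (csubdiff g (x *m A)) <= ell%:E)%E)
  (* algorithm parameters and iterates *)
  (beta nu q delta0 theta0 eps : R)
  (Hbeta : 0 < beta < 2) (Hnu : 0 < nu) (Hq : 0 < q < 1)
  (Hdelta0 : 0 < delta0) (Htheta0 : 0 < theta0) (Heps : 0 < eps)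
  (x u : nat -> 'rV[R]_n) (z : nat -> 'rV[R]_s) (y : nat -> 'rV[R]_p)
  (theta delta gamma_ : nat -> R) (j : nat -> nat)
  (Halg : alg_iterates S A K f g h gradh L beta nu q delta0 theta0 eps
            x u z y theta delta gamma_ j)
  (* hypotheses of the theorem *)
  (gamma : R) (K0 : nat) (Hgamma : 0 < gamma)
  (HK0 : forall k, (K0 <= k)%N ->
     [/\ gamma_ k = gamma,
         delta k = 2 * nu + L + 2 * opnorm A ^+ 2 / gamma
       & normv (z k.+1) <= Num.min (eps / gamma) (Num.sqrt (2 * eps / gamma))])
  (m M : R) (Hm : 0 < m) (HmM : m <= M)
  (HfKx : forall k, (1 <= k)%N ->
     (m%:E < f (x k *m K))%E /\ (f (x k *m K) <= M%:E)%E)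
  (K1 : nat) (HK1 : (K0.+1 <= K1)%N)
  (HK1b : forall k, (K1 <= k)%N ->
     [/\ (m%:E <= (dotv (x k *m K) (y k))%:E - fconj f (y k))%E,
         ((dotv (x k *m K) (y k))%:E - fconj f (y k) <= f (x k *m K))%E
       & (f (x k *m K) <= M%:E)%E])
  (Hcalm : forall w, edom (fconj f) w -> calm_at (fconj f) w)
  (Hesc : ess_strictly_convex g) :
  exists2 zeta : R, 0 < zeta &
    forall k, (K1 <= k)%N ->
      (dist0 (limiting_subdiff
                (Gamma_vec f g h A K S m
                   (2 * nu + L + 2 * opnorm A ^+ 2 / gamma) gamma)
                (pt4 (x k.+1) (y k.+1) (z k.+1) (u k.+1)))
       <= (zeta * (normv (x k - x k.+1) + normv (u k - u k.+1)
                   + normv (z k - z k.+1)))%:E)%E.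
Proof.

(* Bounds on the iterates and the subgradients *)
have [gprop [gcvx glsc]] := Hg; have [_ gN] := gprop.
have [fprop [fcvx flsc]] := Hf; have [_ fN] := fprop.
have gcN z0 : fconj g z0 != -oo%E := fconj_noNy _ _ gprop.
have fcN y0 : fconj f y0 != -oo%E := fconj_noNy _ _ fprop.
set dl := 2 * nu + L + 2 * opnorm A ^+ 2 / gamma.
have dl0 : 0 < dl.
  by have := divr_ge0 (sqr_ge0 (opnorm A)) (ltW Hgamma); rewrite /dl; lra.
have dl_ge0 := ltW dl0; have g_ge0 := ltW Hgamma; have m_ge0 := ltW Hm.
have /andP[b0 b2] := Hbeta; have b_ge0 := ltW b0.
have [_ _ _ alg] := Halg.
have Sx k : S (x k.+1) by have [_ [? _] _ _ _] := alg k.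
have [BX BX0 SBX] := compact_normv_bounded _ HScomp.
have xB k : normv (x k.+1) <= BX by exact: SBX.
have uE k : u k.+1 = (1 - beta) *: u k + beta *: x k.+1 by have [] := alg k.
have [BU BU0 uB] := relaxation_bounded x u beta BX Hbeta BX0 xB uE.
have [BY BY0 yB] := csubdiff_compact_bounded f K S fN HScomp HKS HfKpos.
have [CA CA0 HCA] := mulmx_bounded A; have [CK CK0 HCK] := mulmx_bounded K.
have [CAt CAt0 HCAt] := mulmx_bounded A^T.
have [CKt CKt0 HCKt] := mulmx_bounded K^T.
pose BZ := eps / gamma.
have zB k : (K0 <= k)%N -> normv (z k.+1) <= BZ.
  by move=> /HK0[_ _]; rewrite le_min => /andP[].

(* Proximal points, subgradients of [g] and values of the numerator *)
have prox k : (K0 <= k)%N ->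
    is_prox (fconj g) gamma^-1 (gamma^-1 *: (x k.+1 *m A)) (z k.+1).
  move=> kK; have [gk _ _] := HK0 k kK.
  have [gk1 _ _] := HK0 k.+1 (leqW kK).
  by have [] := alg_iterates_step k Halg Hq Hgamma gk gk1.
have gz k : (K0 <= k)%N ->
    csubdiff g (x k.+1 *m A - gamma *: z k.+1) (z k.+1).
  move=> kK; apply: csubdiff_of_prox_fconj => //; last exact: prox.
  exact: HASdom.
pose G k := fine (fconj g (z k)).
have GE k : (K0 <= k)%N -> fconj g (z k.+1) = (G k.+1)%:E.
  move=> kK; have /csubdiffP[r gr _] := gz k kK.
  by rewrite /G (fconj_csubdiff _ _ _ _ gN (gz k kK) gr).
pose fk k := fine (f (x k *m K)).
have fE k : (0 < k)%N -> f (x k *m K) = (fk k)%:E /\ m <= fk k.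
  move=> /HfKx[mf fM]; rewrite /fk; case: (f _) mf fM => [r| |]//=.
  by rewrite lte_fin => /ltW.
pose N k := dotv (z k) (x k *m A) - G k + h (x k)
  + dl / 2 * normv (x k - u k) ^+ 2 - gamma / 2 * normv (z k) ^+ 2.
have thE k : (K0 <= k)%N -> theta k.+1 = N k.+1 / fk k.+1 /\ 0 < theta k.+1.
  move=> kK; have [gk dk _] := HK0 k kK.
  have [gk1 _ _] := HK0 k.+1 (leqW kK).
  have [_ + th0] := alg_iterates_step k Halg Hq Hgamma gk gk1.
  rewrite dk -/dl (Psi_fin _ _ _ _ _ _ _ _ _ _ (Sx k) (GE k kK)) -EFinM.
  by move=> [thE]; split.
have N0 k : (K0 <= k)%N -> 0 < N k.+1.
  move=> kK; have [E th0] := thE k kK; have [_ mf] := fE k.+1 isT.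
  have f0 : 0 < fk k.+1 by lra.
  by move: th0; rewrite E pmulr_lgt0// invr_gt0.

(* Lipschitz estimate and bound for the numerator *)
have [x0 Sx0] := HS0.
(* Bounds the gradient on [S], whose points are at distance at most [2 BX] from each other. *)
pose Lh := normv (gradh x0) + L * (2 * BX).
have Lh0 : 0 <= Lh by rewrite addr_ge0 ?normv_ge0// !mulr_ge0.
have gradB a : S a -> normv (gradh a) <= Lh.
  move=> Sa; have := ler_normvD (gradh a - gradh x0) (gradh x0); rewrite subrK.
  have := HLip a x0 (HSU _ Sa) (HSU _ Sx0).
  have ax0 : normv (a - x0) <= 2 * BX.
    by have := ler_normvB a x0; have := SBX _ Sa; have := SBX _ Sx0; lra.
  by have := ler_wpM2l HL0 ax0; rewrite /Lh; lra.
have hLip a b : S a -> S b -> `|h a - h b| <= Lh * normv (a - b).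
  move=> Sa Sb.
  have Sab t : 0 <= t <= 1 -> S (b + t *: (a - b)).
    move=> t01; have -> : b + t *: (a - b) = t *: a + (1 - t) *: b.
      by apply/rowP => i; rewrite !mxE; ring.
    exact: HSconv.
  apply: (gradient_lipschitz _ _ _ _ _ _ Hgrad) => t /Sab; first exact: HSU.
  exact: gradB.
pose LN := BZ * CA + Lh + dl * (BX + BU).
have xuB k : normv (x k.+1 - u k.+1) <= BX + BU.
  by apply: le_trans (ler_normvB _ _) _; rewrite lerD.
have NLip i k : (K0 <= i)%N -> (K0 <= k)%N ->
    N i.+1 - N k.+1 <= LN * (normv (x i.+1 - x k.+1) + normv (u i.+1 - u k.+1)).
  move=> iK kK; apply: (value_prox_lipschitz A (fconj g)) => //.
  - exact: prox.
  - exact: GE.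
  - exact: GE.
  - exact: zB.
  - exact: hLip.
have BZ0 : 0 <= BZ := divr_ge0 (ltW Heps) g_ge0.
have LN0 : 0 <= LN.
  by do ?[by [] | exact: sqr_ge0 | apply: addr_ge0 | apply: divr_ge0
         | apply: mulr_ge0].
pose BN := N K0.+1 + LN * (2 * BX + 2 * BU).
have NB k : (K0 <= k)%N -> `|N k.+1| <= BN.
  move=> kK; rewrite gtr0_norm ?N0//.
  have := NLip k K0 kK (leqnn _).
  have dB : normv (x k.+1 - x K0.+1) + normv (u k.+1 - u K0.+1) <= 2 * BX + 2 * BU.
    have := ler_normvB (x k.+1) (x K0.+1); have := ler_normvB (u k.+1) (u K0.+1).
    by have := xB k; have := xB K0; have := uB k.+1; have := uB K0.+1; lra.
  by have := ler_wpM2l LN0 dB; rewrite /BN; lra.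
have BN0 : 0 <= BN := le_trans (normr_ge0 _) (NB K0 (leqnn _)).
(* Rate at which [theta] approaches the new quotient [Q]: the first term is the variation of the
   numerator, the second that of the denominator. *)
pose E := LN / m + BN * (CK * BY) / m ^+ 2.
have E0 : 0 <= E.
  by do ?[by [] | exact: sqr_ge0 | apply: addr_ge0 | apply: divr_ge0
         | apply: mulr_ge0].
(* The first four terms serve the [x]-block, [BN / m * CK] the [y]-block and [dl / beta] the
   [u]-block. *)
pose C := CAt + L + dl + E * (CKt * BY) + BN / m * CK + dl / beta.
have C0 : 0 <= C.
  by do ?[by [] | exact: sqr_ge0 | apply: addr_ge0 | apply: divr_ge0
         | apply: mulr_ge0].
exists (m^-1 * C + 1).
  by rewrite ltr_wpDl// mulr_ge0// invr_ge0 ltW.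

(* Estimate at one iteration *)
move=> k kK1.
(* Since [K1 > K0], the index is a successor [k.+1] with [K0 <= k]; the facts above thus hold both
   for the old iterate [k.+1] and for the new one [k.+2]. *)
case: k kK1 => [|k] kK1; first by have := leq_trans HK1 kK1.
have kK : (K0 <= k)%N by rewrite -ltnS (leq_trans HK1).
set dx := normv (x k.+1 - x k.+2); set du := normv (u k.+1 - u k.+2).
set dz := normv (z k.+1 - z k.+2).
have dx0 : 0 <= dx := normv_ge0 _; have du0 : 0 <= du := normv_ge0 _.
have dz0 : 0 <= dz := normv_ge0 _.
have [fy pr _ _ _] := alg k.+1.
have [_ dk _] := HK0 k.+1 (leqW kK).
have [fkE fkm] := fE k.+1 isT.
have yBk : normv (y k.+2) <= BY := yB _ _ (Sx k) fy.
(* Value of the conjugate of [f] at the new [y], by equality in Fenchel-Young at the old [x]; so [D]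
   is the denominator at the new iterate. *)
pose F := dotv (x k.+1 *m K) (y k.+2) - fk k.+1.
have FE : fconj f (y k.+2) = F%:E := fconj_csubdiff _ _ _ _ fN fy fkE.
pose D := dotv (x k.+2 *m K) (y k.+2) - F.
have Dm : m <= D.
  by have [+ _ _] := HK1b k.+2 (leqW kK1); rewrite FE -EFinB lee_fin.
have D0 : 0 < D by lra.
have Dfk : `|D - fk k.+1| <= CK * BY * dx.
  have -> : D - fk k.+1 = dotv ((x k.+2 - x k.+1) *m K) (y k.+2).
    by rewrite mulmxBl !dotvE /D /F; ring.
  apply: le_trans (dotv_le_normv _ _) _; rewrite mulrAC ler_pM ?normv_ge0//.
  by apply: le_trans (HCK _) _; rewrite normvBC.
pose Q := N k.+2 / D.
have Q0 : 0 <= Q by rewrite divr_ge0// ltW// N0// leqW.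
have QB : Q <= BN / m.
  apply: ler_pM; rewrite ?invr_ge0 ?(ltW D0)//; first exact/ltW/N0/leqW.
    by apply: le_trans (ler_norm _) _; exact/NB/leqW.
  by rewrite lef_pV2.
have thQ : `|theta k.+1 - Q| <= E * (dx + du).
  have [-> _] := thE k kK.
  have NN : `|N k.+1 - N k.+2| <= LN * (dx + du).
    have := NLip k k.+1 kK (leqW kK); have := NLip k.+1 k (leqW kK) kK.
    rewrite (normvBC (x k.+2)) (normvBC (u k.+2)) -/dx -/du => H1 H2.
    by rewrite ler_norml; apply/andP; split; lra.
  apply: le_trans (quotient_diff_le _ _ _ _ _ _ _ _ Hm fkm Dm (NB _ kK) NN Dfk) _.
  have : 0 <= BN * (CK * BY) / m ^+ 2 * du.
    by rewrite !mulr_ge0// invr_ge0 sqr_ge0.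
  by rewrite /E; lra.
set w := _ - (delta _)^-1 *: (z _ *m A^T) in pr.
have nor := is_proj_normal _ _ _ HSconv pr.
(* Here [xi] is the old [K x], and [a] is the point where the proximal step makes the new [z] a
   subgradient of [g]; the normal vector is the scaled projection residual. *)
have sub := Gamma_vec_frechet_subdiff f g h A K S m dl gamma (x k.+2) (y k.+2)
  (z k.+2) (u k.+2) F (G k.+2) (x k.+1 *m K) (x k.+2 *m A - gamma *: z k.+2)
  (gradh (x k.+2)) (dl *: (w - x k.+2)) fcN gcN Hm _ (ltW (N0 k.+1 (leqW kK)))
  (ltW dl0) (ltW Hgamma) (Sx k.+1) FE (GE k.+1 (leqW kK)) _
  (csubdiff_fconj _ _ _ fN fy)
  (fconj_frechet_le _ _ _ _ gN gcvx glsc Hesc (gz k.+1 (leqW kK))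
    (GE k.+1 (leqW kK)))
  (Hgrad _ (HSU _ (Sx k.+1))) _.
apply: dist0_le.
  apply: frechet_limiting_subdiff; apply: sub.
  - by rewrite -/D; lra.
  - by apply: Hcalm; rewrite /edom /= FE ltry.
  - move=> a Sa; rewrite dotvZl; apply: mulr_ge0_le0; first exact: ltW.
    exact: nor.
rewrite -/D -/(N k.+2) -/Q.
rewrite /w dk -/dl x_block_eq ?gt_eqF// opprB.
(* With this [a] the [z]-block is exactly zero. *)
rewrite (addrC (x k.+2 *m A)) subrK subrr.

(* Norms of the blocks *)
set V1 := (X in pt4 X); set V2 := Q *: _; set V4 := dl *: _.
pose T := dx + du + dz.
have T0 : 0 <= T by rewrite /T; lra.
have coef (c t : R) : 0 <= c -> t <= T -> c * t <= c * T.
  by move=> c0; apply: ler_wpM2l.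
have V1B : normv V1 <= (CAt + L + dl + E * (CKt * BY)) * T.
  have h1 : normv ((z k.+2 - z k.+1) *m A^T) <= CAt * T.
    by apply: le_trans (HCAt _) _; rewrite normvBC -/dz coef// /T; lra.
  have h2 : normv (gradh (x k.+2) - gradh (x k.+1)) <= L * T.
    apply: le_trans (HLip _ _ (HSU _ (Sx _)) (HSU _ (Sx _))) _.
    by rewrite normvBC -/dx coef// /T; lra.
  have h3 : normv (dl *: (u k.+1 - u k.+2)) <= dl * T.
    by rewrite normvZ gtr0_norm// -/du coef// /T; lra.
  have h4 : normv ((theta k.+1 - Q) *: (y k.+2 *m K^T)) <= E * T * (CKt * BY).
    rewrite normvZ; apply: ler_pM; rewrite ?normv_ge0//.
      by apply: le_trans thQ _; rewrite coef// /T; lra.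
    by apply: le_trans (HCKt _) _; rewrite ler_wpM2l.
  have := ler_normvD ((z k.+2 - z k.+1) *m A^T) (gradh (x k.+2) - gradh (x k.+1)).
  have := ler_normvD ((z k.+2 - z k.+1) *m A^T + (gradh (x k.+2) - gradh (x k.+1)))
    (dl *: (u k.+1 - u k.+2)).
  have := ler_normvD ((z k.+2 - z k.+1) *m A^T + (gradh (x k.+2) - gradh (x k.+1))
    + dl *: (u k.+1 - u k.+2)) ((theta k.+1 - Q) *: (y k.+2 *m K^T)).
  by rewrite -/V1; lra.
have V2B : normv V2 <= BN / m * CK * T.
  rewrite normvZ ger0_norm// -mulmxBl -mulrA; apply: ler_pM; rewrite ?normv_ge0//.
  by apply: le_trans (HCK _) _; rewrite -/dx coef// /T; lra.
have V4B : normv V4 <= dl / beta * T.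
  (* The relaxation step gives [u' - x' = (1 - beta) (u - x')] and [u - u' = beta (u - x')], with
     primes for the new iterate. *)
  have -> : V4 = (dl / beta * (1 - beta)) *: (u k.+1 - u k.+2).
    by rewrite /V4 uE; apply/rowP => i; rewrite !mxE; field; rewrite gt_eqF.
  have b1 : `|1 - beta| <= 1 by rewrite ler_norml; apply/andP; split; lra.
  have db0 : 0 <= dl / beta := divr_ge0 dl_ge0 b_ge0.
  rewrite normvZ normrM (ger0_norm db0) -/du -[leLHS]mulrA; apply: coef => //.
  by apply: le_trans (ler_wpM2r du0 b1) _; rewrite mul1r /T; lra.
have := normv_pt4 V1 V2 (0 : 'rV[R]_s) V4; rewrite normv0 addr0 => V.
have CT : normv (pt4 V1 V2 (0 : 'rV[R]_s) V4) <= C * T by rewrite /C; lra.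
rewrite normvZ gtr0_norm ?invr_gt0// -/T mulrDl mul1r -mulrA.
apply: ler_wpDr => //; apply: ler_pM; rewrite ?normv_ge0 ?invr_ge0 ?(ltW D0)//.
by rewrite lef_pV2.
Qed.
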